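(* Let $R,F\in\Gamma_0(\mathbb{R}^n)$, $J,G\in\Gamma_0(\mathbb{R}^m)$ and $L:\mathbb{R}^n\to\mathbb{R}^m$ satisfy assumptions (A.1)-(A.4) of the context. Let $\gamma_R,\gamma_J>0$ satisfy $$2\min\{\beta_F,\beta_G\}\,\min\Big\{\frac1{\gamma_J},\frac1{\gamma_R}\Big\}\Big(1-\sqrt{\gamma_J\gamma_R\|L\|^2}\Big)>1 ,$$ and let $\{(x_k,v_k)\}_{k\in\mathbb{N}}$ be generated by the Primal–Dual iteration of the context with $\theta=1$ from arbitrary $x_0\in\mathbb{R}^n$, $v_0\in\mathbb{R}^m$, so that $(x_k,v_k)\to(x^\star,v^\star)$ for some Kuhn–Tucker pair $(x^\star,v^\star)$. Suppose moreover that $R\in\mathrm{PSF}_{x^\star}(\mathcal{M}^R_{x^\star})$ and $J^*\in\mathrm{PSF}_{v^\star}(\mathcal{M}^{J^*}_{v^\star})$ for some sets $\mathcal{M}^R_{x^\star}\ni x^\star$, $\mathcal{M}^{J^*}_{v^\star}\ni v^\star$, and that the non-degeneracy condition $$-L^*v^\star-\nabla F(x^\star)\in\mathrm{ri}\big(\partial R(x^\star)\big),\qquad Lx^\star-\nabla G^*(v^\star)\in\mathrm{ri}\big(\partial J^*(v^\star)\big)$$ holds. Then: (i) There exists $K\in\mathbb{N}$ such that for all $k\ge K$, $(x_k,v_k)\in\mathcal{M}^R_{x^\star}\times\mathcal{M}^{J^*}_{v^\star}$. (ii) Moreover (with such a $K$): (a) if $\mathcal{M}^R_{x^\star}=x^\star+T^R_{x^\star}$,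 then $T^R_{x_k}=T^R_{x^\star}$ and $\bar x_k\in\mathcal{M}^R_{x^\star}$ for all $k>K$; (b) if $\mathcal{M}^{J^*}_{v^\star}=v^\star+T^{J^*}_{v^\star}$, then $T^{J^*}_{v_k}=T^{J^*}_{v^\star}$ for all $k>K$; (c) if $R$ is locally polyhedral around $x^\star$, then for all $k\ge K$: $x_k\in\mathcal{M}^R_{x^\star}=x^\star+T^R_{x^\star}$, $T^R_{x_k}=T^R_{x^\star}$, $\nabla_{\mathcal{M}^R_{x^\star}}R(x_k)=\nabla_{\mathcal{M}^R_{x^\star}}R(x^\star)$ and $\nabla^2_{\mathcal{M}^R_{x^\star}}R(x_k)=0$; (d) if $J^*$ is locally polyhedral around $v^\star$, then for all $k\ge K$: $v_k\in\mathcal{M}^{J^*}_{v^\star}=v^\star+T^{J^*}_{v^\star}$, $T^{J^*}_{v_k}=T^{J^*}_{v^\star}$, $\nabla_{\mathcal{M}^{J^*}_{v^\star}}J^*(v_k)=\nabla_{\mathcal{M}^{J^*}_{v^\star}}J^*(v^\star)$ and $\nabla^2_{\mathcal{M}^{J^*}_{v^\star}}J^*(v_k)=0$.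
   Context: **Problem and assumptions.** $\Gamma_0(\mathbb{R}^n)$ is the set of proper convex lower semicontinuous functions $\mathbb{R}^n\to\,]-\infty,+\infty]$; $J^*$ denotes the Legendre–Fenchel conjugate; $\mathrm{ri}$ is relative interior; $\mathrm{prox}_{\gamma R}(x)=\mathrm{argmin}_z \frac12\|z-x\|^2+\gamma R(z)$. The infimal convolution $(J\,\triangledown\,G)(y)=\inf_{v\in\mathbb{R}^m}J(v)+G(y-v)$. The primal problem is $\min_{x\in\mathbb{R}^n}R(x)+F(x)+(J\,\triangledown\,G)(Lx)$ and its dual is $\min_{v\in\mathbb{R}^m}J^*(v)+G^*(v)+(R^*\,\triangledown\,F^* )(-L^*v)$. Assumptions: (A.1) $R,F\in\Gamma_0(\mathbb{R}^n)$ and $\nabla F$ is $(1/\beta_F)$-Lipschitz continuous for some $\beta_F>0$; (A.2) $J,G\in\Gamma_0(\mathbb{R}^m)$ and $G$ is $\beta_G$-strongly convex for some $\beta_G>0$ (so $\nabla G^*$ is $(1/\beta_G)$-Lipschitz); (A.3) $L:\mathbb{R}^n\to\mathbb{R}^m$ is linear; (A.4) $0\in\mathrm{ran}\big(\partial R+\nabla F+L^*(\partial J\,\square\,\partial G)L\big)$, where $\partial J\,\square\,\partial G=(\partial J^{-1}+\partial G^{-1})^{-1}$. A pair $(x^\star,v^\star)$ is a Kuhn–Tucker pair if $0\in\partial R(x^\star)+L^*v^\star+\nabla F(x^\star)$ and $0\in\partial J^*(v^\star)-Lx^\star+\nabla G^*(v^\star)$; then $x^\star$ solves the primal and $v^\star$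 the dual problem. **Primal–Dual iteration** (parameters $\gamma_R,\gamma_J>0$, $\theta$): $x_{k+1}=\mathrm{prox}_{\gamma_RR}(x_k-\gamma_R\nabla F(x_k)-\gamma_RL^*v_k)$, $\bar x_{k+1}=x_{k+1}+\theta(x_{k+1}-x_k)$, $v_{k+1}=\mathrm{prox}_{\gamma_JJ^*}(v_k-\gamma_J\nabla G^*(v_k)+\gamma_JL\bar x_{k+1})$. It is known that for $\theta=1$ and under (A.1)-(A.4) and the displayed step-size condition the iterates converge to a Kuhn–Tucker pair. **Partial smoothness.** For a convex set $C$, $\mathrm{par}(C)$ is the linear subspace parallel to its affine hull. For $R\in\Gamma_0(\mathbb{R}^n)$ with $\partial R(x)\neq\emptyset$, $T^R_x:=\mathrm{par}(\partial R(x))^\perp$. $R$ is partly smooth at $x$ relative to a set $\mathcal{M}\ni x$, written $R\in\mathrm{PSF}_x(\mathcal{M})$, if (1) $\mathcal{M}$ is a $C^2$-smooth embedded submanifold of $\mathbb{R}^n$ around $x$ and $R|_{\mathcal{M}}$ is $C^2$ around $x$; (2) the tangent space of $\mathcal{M}$ at $x$ equals $T^R_x$; (3) the set-valued map $\partial R$ is continuous (inner and outer semicontinuous) at $x$ relative to $\mathcal{M}$. Such an $\mathcal{M}$ is only relevant near $x$; equalities such as $\mathcal{M}=x+T^R_x$ are understood locally near $x$. **Riemannian gradient and Hessian.** For a function $R$ that is $C^2$ along $\mathcal{M}$ near $x$ and $x'\in\mathcal{M}$ near $x$ with tangent space $\mathcal{T}$, $\nabla_{\mathcal{M}}R(x')\in\mathcal{T}$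 is defined by $\langle\nabla_{\mathcal{M}}R(x'),h\rangle=\frac{d}{dt}R(\mathrm{P}_{\mathcal{M}}(x'+th))|_{t=0}$ for $h\in\mathcal{T}$, and $\nabla^2_{\mathcal{M}}R(x')$ is the symmetric linear map on $\mathcal{T}$ with $\langle\nabla^2_{\mathcal{M}}R(x')h,h\rangle=\frac{d^2}{dt^2}R(\mathrm{P}_{\mathcal{M}}(x'+th))|_{t=0}$, where $\mathrm{P}_{\mathcal{M}}$ is the projection onto $\mathcal{M}$. **Locally polyhedral** around a point means that the function coincides in a neighbourhood of that point with a polyhedral function (one whose epigraph is a polyhedron). *)

(* Defs.v *)
From HB Require Import structures.
From mathcomp Require Import all_boot all_order all_algebra.
From mathcomp Require Import all_classical all_reals all_analysis.

Set Implicit Arguments.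
Unset Strict Implicit.
Unset Printing Implicit Defensive.

Import Order.TTheory GRing.Theory Num.Theory.
Import numFieldNormedType.Exports.

Local Open Scope classical_set_scope.
Local Open Scope ring_scope.

(* R^n is 'rV[K]_n with K : realType.  Its canonical normed structure, whose
   norm is written `|x|, is the sup norm: it gives the usual topology and
   differentials, but every metric quantity below uses the Euclidean [enorm]. *)

Section Euclidean.
Context {K : realType}.

Definition dotp n (x y : 'rV[K]_n) : K := \sum_i x 0 i * y 0 i.

Definition enorm n (x : 'rV[K]_n) : K := Num.sqrt (dotp x x).

Definition adjoint n m (L : {linear 'rV[K]_n -> 'rV[K]_m}) (v : 'rV[K]_m) :
  'rV[K]_n := v *m (lin1_mx L)^T.

Lemma dotp_adjoint n m (L : {linear 'rV[K]_n -> 'rV[K]_m}) x v :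
  dotp (L x) v = dotp x (adjoint L v).
Proof.
have dotE p (a b : 'rV[K]_p) : dotp a b = (a *m b^T) 0 0.
  by rewrite mxE; apply: eq_bigr => i _; rewrite mxE.
by rewrite !dotE /adjoint trmx_mul trmxK mulmxA mul_rV_lin1.
Qed.

Definition opnorm n m (L : {linear 'rV[K]_n -> 'rV[K]_m}) : K :=
  sup [set enorm (L x) | x in [set x | enorm x <= 1]].

Definition grad n (f : 'rV[K]_n -> K) (x : 'rV[K]_n) : 'rV[K]_n :=
  \row_i 'D_(delta_mx 0 i) f x.

End Euclidean.

Section ConvexSets.
Context {K : realType} {n : nat}.
Local Notation V := 'rV[K]_n.
Implicit Types (C : set V) (u y z : V).

Definition affine_hull C : set V := [set y |
  exists (p : nat) (a : 'I_p -> K) (c : 'I_p -> V),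
    [/\ forall i, C (c i), \sum_i a i = 1 & y = \sum_i a i *: c i]].

Definition par C : set V := [set y - z | y in affine_hull C & z in affine_hull C].

Definition rel_interior C : set V := [set u | C u /\
  exists2 e : K, 0 < e &
    forall y, affine_hull C y -> enorm (y - u) < e -> C y].

Definition orthogonal C : set V := [set h | forall u, C u -> dotp h u = 0].

Definition translate (x : V) C : set V := [set y | C (y - x)].

Definition locally_equal (x : V) (A B : set V) : Prop :=
  \forall y \near x, A y <-> B y.

(* A default value is returned when there is no nearest point; near a point
   around which M is a C^2 submanifold, the nearest point exists and is
   unique. *)
Definition proj (M : set V) (y : V) : V :=
  xget 0 [set z | M z /\ forall w, M w -> enorm (y - z) <= enorm (y - w)].

End ConvexSets.

Section ConvexFunctions.
Context {K : realType} {n : nat}.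
Local Notation V := 'rV[K]_n.
Implicit Types f : V -> \bar K.

Definition econvex f : Prop := forall (x y : V) (t : K), 0 < t -> t < 1 ->
  (f (t *: x + (1 - t) *: y)%R <= t%:E * f x + (1 - t)%R%:E * f y)%E.

Definition strongly_convex (b : K) f : Prop :=
  forall (x y : V) (t : K), 0 < t -> t < 1 ->
  (f (t *: x + (1 - t) *: y)%R
     + (b / 2 * (t * (1 - t)) * enorm (x - y) ^+ 2)%R%:E
   <= t%:E * f x + (1 - t)%R%:E * f y)%E.

Definition proper f : Prop :=
  (forall x, (-oo < f x)%E) /\ exists x, (f x < +oo)%E.

Definition Gamma0 f : Prop :=
  [/\ proper f, econvex f & lower_semicontinuous f].

Definition conjugate f (u : V) : \bar K :=
  ereal_sup (range (fun x => (dotp u x)%:E - f x)%E).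

Definition subdiff f (x : V) : set V :=
  [set u | forall y, (f x + (dotp u (y - x)%R)%:E <= f y)%E].

Definition egrad f : V -> V := grad (fine \o f).

Definition lipschitz_gradient (c : K) f : Prop :=
  [/\ forall x, f x \is a fin_num,
      forall x, differentiable (fine \o f) x &
      forall x y, enorm (egrad f x - egrad f y) <= c * enorm (x - y)].

(* The argmin defining the proximal point, as a set: it is a singleton when
   f is in Gamma0. *)
Definition prox (g : K) f (x : V) : set V := [set p | forall z,
  ((2^-1 * enorm (p - x) ^+ 2)%R%:E + g%:E * f p
   <= (2^-1 * enorm (z - x) ^+ 2)%R%:E + g%:E * f z)%E].

Definition polyhedral f : Prop :=
  exists (p : nat) (a : 'I_p -> V) (b c : 'I_p -> K),
    forall (x : V) (t : K),
      (f x <= t%:E)%E <-> forall i, dotp (a i) x + b i * t <= c i.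

Definition locally_polyhedral f (x : V) : Prop :=
  exists2 g, polyhedral g & \forall y \near x, f y = g y.

(* T^f_x *)
Definition Tspace f (x : V) : set V := orthogonal (par (subdiff f x)).

End ConvexFunctions.

Section SetValuedMaps.
Context {K : realType} {n : nat}.
Local Notation V := 'rV[K]_n.
Implicit Types (A B S : V -> set V) (M : set V).

Definition inv_map A : V -> set V := fun u => [set x | A x u].

Definition sum_map A B : V -> set V :=
  fun x => [set a + b | a in A x & b in B x].

Definition parallel_sum A B : V -> set V :=
  inv_map (sum_map (inv_map A) (inv_map B)).

(* Painleve-Kuratowski outer and inner limits of S y as y tends to x in M *)
Definition outer_limit M S (x : V) : set V := [set u |
  forall U W, nbhs u U -> nbhs x W ->
    exists y, [/\ M y, W y & S y `&` U !=set0]].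

Definition inner_limit M S (x : V) : set V := [set u |
  forall U, nbhs u U -> \forall y \near within M (nbhs x), S y `&` U !=set0].

Definition continuous_rel M S (x : V) : Prop :=
  outer_limit M S x `<=` S x /\ S x `<=` inner_limit M S x.

End SetValuedMaps.

Section Submanifolds.
Context {K : realType}.

Definition C2_near (V W : normedModType K) (f : V -> W) (x : V) : Prop :=
  \forall y \near x, [/\ differentiable f y,
    forall a, differentiable ('D_a f) y &
    forall a b, {for y, continuous ('D_b ('D_a f))}].

Context {n : nat}.
Local Notation V := 'rV[K]_n.
Implicit Types (M : set V) (f : V -> \bar K).

(* Slice chart: psi is a C^2 diffeomorphism near x, with inverse phi, which
   carries M onto R^d x {0}. *)
Definition C2_submanifold M (x : V) : Prop :=
  M x /\ exists (d : nat) (psi phi : V -> V),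
    [/\ C2_near psi x /\ C2_near phi (psi x),
        \forall y \near x, phi (psi y) = y,
        \forall z \near psi x, psi (phi z) = z &
        \forall y \near x,
          M y <-> forall i : 'I_n, (d <= i)%N -> psi y 0 i = 0].

(* f is C^2 along M around x: on M it agrees with a C^2 function of the
   ambient space. *)
Definition C2_along M f (x : V) : Prop :=
  exists2 g : V -> K, C2_near g x & \forall y \near x, M y -> f y = (g y)%:E.

(* Velocities at x of the curves lying in M *)
Definition tangent_space M (x : V) : set V := [set h |
  exists gam : K -> V, [/\ gam 0 = x, \forall t \near (0 : K), M (gam t) &
    is_derive (0 : K) 1 gam h]].

Definition partly_smooth f M (x : V) : Prop :=
  [/\ subdiff f x !=set0,
      C2_submanifold M x /\ C2_along M f x,
      tangent_space M x = Tspace f x &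
      continuous_rel M (subdiff f) x].

(* The function t |-> f (P_M (x + t h)), which is finite near 0 when f is C^2
   along M *)
Definition along_proj M f (x h : V) (t : K) : K :=
  fine (f (proj M (x + t *: h))).

(* "g is the Riemannian gradient of f at x": the existence of the derivatives
   is part of the predicate, and g is unique. *)
Definition is_riem_grad M f (x g : V) : Prop :=
  tangent_space M x g /\
  forall h, tangent_space M x h ->
    is_derive (0 : K) 1 (along_proj M f x h) (dotp g h).

(* "h |-> h *m H is, on the tangent space, the Riemannian Hessian of f at x" *)
Definition is_riem_hess M f (x : V) (H : 'M[K]_n) : Prop :=
  let T := tangent_space M x in
  [/\ forall h, T h -> T (h *m H),
      forall h h', T h -> T h' -> dotp (h *m H) h' = dotp h (h' *m H) &
      forall h, T h ->
        (\forall t \near (0 : K), derivable (along_proj M f x h) t 1) /\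
        is_derive (0 : K) 1 (derive1 (along_proj M f x h)) (dotp (h *m H) h)].

End Submanifolds.

Section PrimalDual.
Context {K : realType} {n m : nat}.
Variables (R F : 'rV[K]_n -> \bar K) (J G : 'rV[K]_m -> \bar K).
Variable L : {linear 'rV[K]_n -> 'rV[K]_m}.

(* 0 \in ran (dR + grad F + L^* (dJ [] dG) L) *)
Definition range_condition : Prop := exists x u v,
  [/\ subdiff R x u, parallel_sum (subdiff J) (subdiff G) (L x) v &
      u + egrad F x + adjoint L v = 0].

Definition Kuhn_Tucker (x : 'rV[K]_n) (v : 'rV[K]_m) : Prop :=
  (exists2 u, subdiff R x u & u + adjoint L v + egrad F x = 0) /\
  (exists2 w, subdiff (conjugate J) v w &
     w - L x + egrad (conjugate G) v = 0).

(* xbar 0 is irrelevant *)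
Definition primal_dual_iteration (gR gJ theta : K)
    (x xbar : nat -> 'rV[K]_n) (v : nat -> 'rV[K]_m) : Prop := forall k,
  [/\ prox gR R (x k - gR *: egrad F (x k) - gR *: adjoint L (v k)) (x k.+1),
      xbar k.+1 = x k.+1 + theta *: (x k.+1 - x k) &
      prox gJ (conjugate J)
        (v k - gJ *: egrad (conjugate G) (v k) + gJ *: L (xbar k.+1))
        (v k.+1)].

End PrimalDual.

(* Main.v *)
(** A proximal step gives a subgradient of R at x_(k+1), and continuity of the
    gradients (that of the conjugate of G is Lipschitz because G is strongly convex)
    shows that these subgradients converge to the vector required by
    non-degeneracy; likewise for the conjugate of J.  So everything reduces to one
    partly smooth function f and subgradients u_k at x_k with x_k -> xs and
    u_k -> us, where us is relatively interior to the subdifferential at xs.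
    If x_k stayed outside M, its normalized offset from M would have a limit d that
    is not tangent to M, so us could be moved within the subdifferential at xs along
    some nu with <nu, d> > 0; inner semicontinuity carries the perturbed subgradient
    to nearby points of M, which contradicts monotonicity.  In the locally
    polyhedral case f coincides near xs with its directional derivative at xs; hence
    subgradients at nearby points are subgradients at xs, M is locally xs + T, and f
    is affine on M. *)
Require Import Defs.
From mathcomp Require Import all_boot all_order all_algebra.
From mathcomp Require Import all_classical all_reals all_analysis.
From mathcomp Require Import ring lra zify.
Import Order.TTheory GRing.Theory Num.Theory.
Import numFieldNormedType.Exports.
Local Open Scope classical_set_scope.
Local Open Scope ring_scope.
Set Implicit Arguments.
Unset Strict Implicit.
Unset Printing Implicit Defensive.

(** * Euclidean inner product and its comparison with the sup norm *)

Section DotProduct.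
Context {K : realType} {n : nat}.
Implicit Types (a b c : 'rV[K]_n) (s t : K).

Lemma dotpC a b : dotp a b = dotp b a.
Proof. by apply: eq_bigr => i _; rewrite mulrC. Qed.

Lemma dotpDl a b c : dotp (a + b) c = dotp a c + dotp b c.
Proof. by rewrite -big_split /=; apply: eq_bigr => i _; rewrite mxE mulrDl. Qed.

Lemma dotpZl s a b : dotp (s *: a) b = s * dotp a b.
Proof. by rewrite mulr_sumr; apply: eq_bigr => i _; rewrite mxE mulrA. Qed.

Lemma dotpDr a b c : dotp a (b + c) = dotp a b + dotp a c.
Proof. by rewrite dotpC dotpDl !(dotpC _ a). Qed.

Lemma dotpZr s a b : dotp a (s *: b) = s * dotp a b.
Proof. by rewrite dotpC dotpZl dotpC. Qed.

Lemma dotpNl a b : dotp (- a) b = - dotp a b.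
Proof. by rewrite -scaleN1r dotpZl mulN1r. Qed.

Lemma dotpNr a b : dotp a (- b) = - dotp a b.
Proof. by rewrite dotpC dotpNl dotpC. Qed.

Lemma dotpBl a b c : dotp (a - b) c = dotp a c - dotp b c.
Proof. by rewrite dotpDl dotpNl. Qed.

Lemma dotpBr a b c : dotp a (b - c) = dotp a b - dotp a c.
Proof. by rewrite dotpDr dotpNr. Qed.

Lemma dotp0l a : dotp 0 a = 0.
Proof. by rewrite -(scale0r 0) dotpZl mul0r. Qed.

Lemma dotp0r a : dotp a 0 = 0.
Proof. by rewrite dotpC dotp0l. Qed.

Lemma dotp_suml I r (P : pred I) (s : I -> K) (f : I -> 'rV[K]_n) b :
  dotp (\sum_(i <- r | P i) s i *: f i) b =
  \sum_(i <- r | P i) s i * dotp (f i) b.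
Proof.
elim/big_rec2: _ => [|i y z _ <-]; first exact: dotp0l.
by rewrite dotpDl dotpZl.
Qed.

Lemma dotp_deltal i a : dotp (delta_mx 0 i) a = a 0 i.
Proof.
rewrite /dotp (bigD1 i) //= big1 ?addr0; first by rewrite mxE !eqxx mul1r.
by move=> j /negbTE ji; rewrite mxE ji andbF mul0r.
Qed.

Lemma dotp_ge0 a : 0 <= dotp a a.
Proof. by apply: sumr_ge0 => i _; rewrite -expr2 sqr_ge0. Qed.

Lemma sqr_coord_le_dotp a i : a 0 i ^+ 2 <= dotp a a.
Proof.
rewrite /dotp (bigD1 i) //= -expr2 lerDl.
by apply: sumr_ge0 => j _; rewrite -expr2 sqr_ge0.
Qed.

Lemma dotp_eq0 a : dotp a a = 0 -> a = 0.
Proof.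
move=> a0; apply/rowP => i; rewrite mxE; apply/eqP; rewrite -sqrf_eq0.
by rewrite eq_le sqr_ge0 -a0 sqr_coord_le_dotp.
Qed.

Lemma sqr_enorm a : enorm a ^+ 2 = dotp a a.
Proof. by rewrite /enorm sqr_sqrtr ?dotp_ge0. Qed.

Lemma enorm_ge0 a : 0 <= enorm a.
Proof. exact: sqrtr_ge0. Qed.

Lemma enormZ s a : enorm (s *: a) = `|s| * enorm a.
Proof.
by rewrite /enorm dotpZl dotpZr mulrA -expr2 sqrtrM ?sqr_ge0// sqrtr_sqr.
Qed.

Lemma enorm0 : enorm (0 : 'rV[K]_n) = 0.
Proof. by rewrite /enorm dotp0l sqrtr0. Qed.

Lemma enorm_le0 a : enorm a <= 0 -> a = 0.
Proof.
move=> a0; apply: dotp_eq0; rewrite -sqr_enorm; apply/eqP.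
by rewrite sqrf_eq0 eq_le a0 enorm_ge0.
Qed.

Lemma coord_le_norm a i : `|a 0 i| <= `|a|.
Proof.
rewrite [leRHS]mx_normrE.
exact: (@le_bigmax _ _ _ 0 (fun j => `|a j.1 j.2|) (0, i)).
Qed.

Lemma norm_le_coord a s : 0 <= s -> (forall i, `|a 0 i| <= s) -> `|a| <= s.
Proof.
move=> s0 H; rewrite [leLHS]mx_normrE; apply/bigmax_leP; split => //= -[i j] _.
by rewrite (ord1 i); exact: H.
Qed.

Lemma sqr_norm_le_dotp a : `|a| ^+ 2 <= dotp a a.
Proof.
rewrite -sqr_enorm; apply: lerXn2r; rewrite ?nnegrE ?enorm_ge0//.
apply: norm_le_coord => [|i]; first exact: enorm_ge0.
by rewrite -sqrtr_sqr ler_wsqrtr// sqr_coord_le_dotp.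
Qed.

Lemma normr_dotp_le a b : `|dotp a b| <= n%:R * (`|a| * `|b|).
Proof.
apply: le_trans (ler_norm_sum _ _ _) _.
rewrite mulr_natl.
have -> : `|a| * `|b| *+ n = \sum_(i < n) `|a| * `|b|.
  by rewrite sumr_const card_ord.
by apply: ler_sum => i _; rewrite normrM ler_pM// coord_le_norm.
Qed.

Lemma cvg_coord T (F : set_system T) (f : T -> 'rV[K]_n) a i :
  f @ F --> a -> f z 0 i @[z --> F] --> a 0 i.
Proof.
by move=> fa; have := cvg_comp _ _ fa (@coord_continuous K 1 n 0 i a).
Qed.

Lemma cvg_dotp T (F : set_system T) {FF : Filter F} (f g : T -> 'rV[K]_n) a b :
  f @ F --> a -> g @ F --> b -> dotp (f z) (g z) @[z --> F] --> dotp a b.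
Proof.
move=> fa gb; apply: cvg_big => [|i _]; first exact: add_continuous.
by apply: cvgM; exact: cvg_coord.
Qed.

End DotProduct.

(** * Affine hulls, parallel subspaces and orthogonal projection *)

Section Subspaces.
Context {K : realType} {n : nat}.
Local Notation V := 'rV[K]_n.
Local Notation orthogonal := Defs.orthogonal.
Implicit Types (C S : set V) (h u w : V).

Lemma orthogonal0 C : orthogonal C 0.
Proof. by move=> u _; rewrite dotp0l. Qed.

Lemma orthogonalD C h w :
  orthogonal C h -> orthogonal C w -> orthogonal C (h + w).
Proof. by move=> hC wC u Cu; rewrite dotpDl hC ?wC// addr0. Qed.

Lemma orthogonalZ C (s : K) h : orthogonal C h -> orthogonal C (s *: h).
Proof. by move=> hC u Cu; rewrite dotpZl hC// mulr0. Qed.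

Lemma orthogonalN C h : orthogonal C h -> orthogonal C (- h).
Proof. by rewrite -scaleN1r; exact: orthogonalZ. Qed.

Lemma orthogonalB C h w :
  orthogonal C h -> orthogonal C w -> orthogonal C (h - w).
Proof. by move=> hC wC; apply: orthogonalD hC (orthogonalN wC). Qed.

Lemma sub_affine_hull C : C `<=` affine_hull C.
Proof.
move=> u Cu; exists 1%N, (fun=> 1), (fun=> u); split => //.
  by rewrite big_ord1.
by rewrite big_ord1 scale1r.
Qed.

Lemma affine_hull_line C y z (s : K) :
  affine_hull C y -> affine_hull C z -> affine_hull C (y + s *: (z - y)).
Proof.
move=> [p [a [c [Cc a1 ->]]]] [q [b [d [Cd b1 ->]]]].
exists (p + q)%N,
  (fun i => match fintype.split i with inl j => (1 - s) * a j | inr j => s * b j end),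
  (fun i => match fintype.split i with inl j => c j | inr j => d j end).
split.
- by move=> i; case: (fintype.split i).
- rewrite big_split_ord /=.
  under eq_bigr do rewrite (unsplitK (inl _)).
  under [X in _ + X]eq_bigr do rewrite (unsplitK (inr _)).
  by rewrite -!mulr_sumr a1 b1 !mulr1 subrK.
- rewrite big_split_ord /=.
  under [X in _ = X + _]eq_bigr do rewrite (unsplitK (inl _)) -scalerA.
  under [X in _ = _ + X]eq_bigr do rewrite (unsplitK (inr _)) -scalerA.
  rewrite -!scaler_sumr scalerBr scalerBl scale1r.
  by rewrite addrA addrAC.
Qed.

Lemma affine_hull_par C u w (s : K) :
  affine_hull C u -> par C w -> affine_hull C (u + s *: w).
Proof.
move=> Cu [y Cy [z Cz <-]].
(* This point is the midpoint of [u + 2s(y - u)] and [u - 2s(z - u)], each on a line through two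
   points of the hull. *)
suff -> : u + s *: (y - z) = (u + (2 * s) *: (y - u)) + 2^-1 *:
    ((u + (- (2 * s)) *: (z - u)) - (u + (2 * s) *: (y - u))).
  by do 2!apply: affine_hull_line => //; exact: affine_hull_line.
by apply/rowP => i; rewrite !mxE; field.
Qed.

Lemma parN C w : par C w -> par C (- w).
Proof. by move=> [y Cy [z Cz <-]]; exists z => //; exists y; rewrite ?opprB. Qed.

(** [dotp h] is linear and the coefficients of an affine combination sum to 1, so a value common to
    all of [C] persists on the affine hull. *)
Lemma orthogonal_parP C h :
  orthogonal (par C) h <-> {in C &, forall u w, dotp h u = dotp h w}.
Proof.
split=> [hC u w /set_mem Cu /set_mem Cw|hC w].
  apply/eqP; rewrite -subr_eq0 -dotpBr; apply/eqP/hC.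
  by exists u; [exact: sub_affine_hull|exists w => //; exact: sub_affine_hull].
have hull y u : C u -> affine_hull C y -> dotp h y = dotp h u.
  move=> Cu [p [a [c [Cc a1 ->]]]].
  rewrite dotpC dotp_suml -[RHS]mul1r -a1 mulr_suml; apply: eq_bigr => i _.
  by rewrite dotpC (hC (c i) u)//; exact: mem_set.
move=> [y Cy [z Cz <-]].
(* An empty sum cannot be 1, so the combination has a first point, which serves as reference point
   of [C]. *)
have [p [a [c [Cc a1 _]]]] := Cz.
case: p a c Cc a1 => [|p] a c Cc a1.
  by move: a1; rewrite big_ord0 => /eqP; rewrite eq_sym oner_eq0.
by rewrite dotpBr (hull y (c ord0))// (hull z (c ord0))// subrr.
Qed.

Lemma rel_interior_par C u w : rel_interior C u -> par C w ->
  exists2 e : K, 0 < e & C (u + e *: w).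
Proof.
move=> [Cu [e e0 He]] Cw.
have N1 : 0 < enorm w + 1 by rewrite ltr_wpDl ?enorm_ge0.
exists (e / (enorm w + 1)); first by rewrite divr_gt0.
apply: He; first by apply: affine_hull_par Cw; exact: sub_affine_hull.
rewrite addrAC subrr add0r enormZ gtr0_norm ?divr_gt0//.
by rewrite mulrAC ltr_pdivrMr// ltr_pM2l// ltrDl.
Qed.

(** A matrix of largest rank among those with row space inside [S] works: adjoining a vector of [S]
    outside its row space would raise the rank. *)
Lemma subspace_rowspace S : S 0 ->
  (forall h w, S h -> S w -> S (h + w)) -> (forall s h, S h -> S (s *: h)) ->
  exists A : 'M[K]_n, forall h, S h <-> (h <= A)%MS.
Proof.
move=> S0 SD SZ.
pose P r := `[< exists2 A : 'M[K]_n,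
  forall h : V, (h <= A)%MS -> S h & \rank A = r >].
have P0 : exists r, P r.
  exists 0%N; apply/asboolP; exists 0; last exact: mxrank0.
  by move=> h; rewrite submx0 => /eqP ->.
have Pn r : P r -> (r <= n)%N.
  by move=> /asboolP[A _ <-]; exact: rank_leq_col.
have [r /asboolP[A AS rA] rmax] := ex_maxnP P0 Pn.
exists A => h; split => [Sh|/AS//].
apply: contraT => nhA; have : P (\rank (A + h)%MS).
  apply/asboolP; exists (A + h)%MS => // w /sub_addsmxP[[a b] /= ->].
  apply: SD; first by apply: AS; rewrite submxMl.
  by rewrite (mx11_scalar b) mul_scalar_mx; exact: SZ.
move=> /rmax; rewrite -rA leqNgt => /negP[]; apply: rank_ltmx.
by rewrite ltmxE addsmxSl /=; apply: contra nhA; apply: submx_trans (addsmxSr _ _).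
Qed.

(** With a basis of [S] as the rows of [B], the projection is [h B^T (B B^T)^-1 B]; the Gram matrix
    is invertible because the inner product is definite. *)
Lemma orthogonal_projection S : S 0 ->
  (forall h w, S h -> S w -> S (h + w)) -> (forall s h, S h -> S (s *: h)) ->
  forall h, exists2 p, S p & orthogonal S (h - p).
Proof.
move=> S0 SD SZ h; have [A SA] := subspace_rowspace S0 SD SZ.
have [B fB Bp] : exists2 B : 'M[K]_(\rank A, n), row_free B &
    forall w : V, S w <-> (w <= B)%MS.
  by exists (row_base A) => [|w]; rewrite ?row_base_free// SA eq_row_base.
pose Q := B *m B^T.
have dotE (a b : V) : dotp a b = (a *m b^T) 0 0.
  by rewrite mxE; apply: eq_bigr => i _; rewrite mxE.
have uQ : Q \in unitmx.
  rewrite -row_free_unit -kermx_eq0; apply/rowV0P => w /sub_kermxP wQ.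
  have : dotp (w *m B) (w *m B) = 0.
    by rewrite dotE trmx_mul mulmxA -(mulmxA w) wQ mul0mx mxE.
  move=> /dotp_eq0 /eqP; rewrite mulmx_free_eq0//.
  by move/eqP.
exists (h *m B^T *m invmx Q *m B); first by apply/Bp; rewrite submxMl.
move=> u /Bp /submxP[D ->].
rewrite dotE trmx_mul mulmxA mulmxBl -(mulmxA _ B B^T) mulmxKV//.
by rewrite subrr mul0mx mxE.
Qed.

End Subspaces.

(** * Derivatives along lines and strict differentiability *)

Section Calculus.
Context {K : realType}.

Lemma is_derive_cvg (V W : normedModType K) (f : V -> W) (a v : V) (l : W) :
  is_derive a v f l <-> h^-1 *: (f (h *: v + a) - f a) @[h --> 0^'] --> l.
Proof.
split=> [[fav <-]|fl]; first exact: fav.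
by apply: DeriveDef; [exact: cvgP fl|exact: cvg_lim fl].
Qed.

Lemma is_derive_line (V W : normedModType K) (f : V -> W) (z h : V) (t : K) :
  differentiable f (z + t *: h) ->
  is_derive t 1 (fun s => f (z + s *: h)) ('D_h f (z + t *: h)).
Proof.
move=> df; apply/is_derive_cvg.
have /is_derive_cvg : is_derive (z + t *: h) h f ('D_h f (z + t *: h)).
  exact/derivableP/diff_derivable.
apply: cvg_trans; apply: near_eq_cvg; apply: nearW => s /=.
congr (_ *: (f _ - _)).
by rewrite scalerDl /= [s *: 1]mulr1 addrCA.
Qed.

Lemma is_derive_coord (V : normedModType K) n (f : V -> 'rV[K]_n) a v l i :
  is_derive a v f l -> is_derive a v (fun w => f w 0 i) (l 0 i).
Proof.
move=> /is_derive_cvg fl; apply/is_derive_cvg.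
have H := cvg_coord (i := i) fl.
refine (cvg_trans (near_eq_cvg _) H); by apply: nearW => s /=; rewrite !mxE.
Qed.

Lemma derive_sum_delta n (W : normedModType K) (f : 'rV[K]_n -> W) x h :
  differentiable f x ->
  'D_h f x = \sum_j h 0 j *: 'D_(delta_mx 0 j) f x.
Proof.
move=> df; rewrite deriveE// {1}(row_sum_delta h) linear_sum.
by apply: eq_bigr => j _; rewrite linearZ/= -deriveE.
Qed.

(** The mean value theorem on the segment from [y] to [x], applied to each coordinate, reduces the
    claim to the closeness of the partial derivatives to those at [x0]. *)
Lemma strictly_differentiable n p (f : 'rV[K]_n -> 'rV[K]_p) x0 :
  (\forall x \near x0, differentiable f x) ->
  (forall a, {for x0, continuous ('D_a f)}) ->
  forall e : K, 0 < e -> exists2 d : K, 0 < d & forall x y,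
    ball x0 d x -> ball x0 d y ->
    `|f x - f y - 'D_(x - y) f x0| <= e * `|x - y|.
Proof.
move=> df cf e e0; pose e' := e / n.+1%:R.
have e'0 : 0 < e' by rewrite divr_gt0.
have : \forall x \near x0, differentiable f x /\
    forall j : 'I_n, `|'D_(delta_mx 0 j) f x - 'D_(delta_mx 0 j) f x0| <= e'.
  near=> x; split; first by near: x.
  near: x; apply: filter_forall => j.
  by have /cvgrPdistC_le := cf (delta_mx 0 j); exact.
move=> /nbhs_ballP[d /= d0 dP]; exists d => // x y xd yd.
pose z t := y + t *: (x - y).
have zd (t : K) : t \in `[0, 1] -> ball x0 d (z t).
  rewrite in_itv /= => /andP[t0 t1]; rewrite -ball_normE /=.
  have -> : x0 - z t = (1 - t) *: (x0 - y) + t *: (x0 - x).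
    by apply/rowP => i; rewrite !mxE; ring.
  apply: le_lt_trans (ler_normD _ _) _; rewrite !normrZ !ger0_norm ?subr_ge0//.
  move: xd yd; rewrite -ball_normE /= => xd yd.
  have [->|t0'] := eqVneq t 0; first by rewrite subr0 mul1r mul0r addr0.
  rewrite -[ltRHS]mul1r -[X in X * d](subrK t) [ltRHS]mulrDl.
  apply: ler_ltD; first by rewrite ler_wpM2l ?subr_ge0// ltW.
  by rewrite ltr_pM2l// lt_neqAle eq_sym t0'.
apply: norm_le_coord => [|i]; first by rewrite mulr_ge0// ltW.
have der (t : K) : t \in `[0, 1] -> is_derive t 1 (fun s => f (z s) 0 i)
    (('D_(x - y) f (z t)) 0 i).
  move=> t01; apply: is_derive_coord; apply: is_derive_line.
  by have [] := dP _ (zd _ t01).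
pose g (t : K) := f (z t) 0 i; pose dg (t : K) := 'D_(x - y) f (z t) 0 i.
have cg : {within `[0, 1], continuous g}.
  by apply: derivable_within_continuous => t t01; have [] := der _ t01.
have dgE (t : K) : t \in `]0, 1[ -> is_derive t 1 g (dg t).
  by move=> t01; apply: der; apply: subset_itv_oo_cc t01.
have [c c01] := @MVT_segment K g dg 0 1 ler01 dgE cg.
have [dfc ec] := dP _ (zd _ c01).
have [df0 _] := dP _ (ballxx _ d0).
rewrite /g /dg subr0 mulr1 /z scale1r scale0r addr0 subrKC !mxE => ->.
rewrite -/(z c) (derive_sum_delta (x - y) dfc) (derive_sum_delta (x - y) df0).
rewrite !summxE -sumrB; apply: le_trans (ler_norm_sum _ _ _) _.
apply: (@le_trans _ _ (\sum_(j < n) `|x - y| * e')).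
  apply: ler_sum => j _; rewrite !mxE -mulrBr normrM ler_pM//.
    by have := coord_le_norm (x - y) j; rewrite !mxE.
  apply: le_trans (ec j); apply: le_trans (coord_le_norm _ i).
  by rewrite !mxE.
rewrite sumr_const card_ord -mulr_natl /e' mulrCA [leRHS]mulrC ler_wpM2l//.
by rewrite mulrCA ler_piMr ?(ltW e0)// ler_pdivrMr// mul1r ler_nat.
Unshelve. all: by end_near. Qed.

End Calculus.

(** * Slice charts and a local retraction onto the manifold *)

Section Charts.
Context {K : realType} {n : nat}.
Local Notation V := 'rV[K]_n.
Implicit Types M : set V.

Definition head_coords (d : nat) (z : V) : V :=
  \row_i (if (i < d)%N then z 0 i else 0).

Lemma head_coords_dist d (y z : V) :
  `|head_coords d y - head_coords d z| <= `|y - z|.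
Proof.
apply: norm_le_coord => // i; rewrite !mxE.
case: ifP => _; last by rewrite subrr normr0.
by have := coord_le_norm (y - z) i; rewrite !mxE.
Qed.

Lemma continuous_head_coords d : continuous (head_coords d).
Proof.
move=> y; apply/(@cvgrPdist_lt _ _ _ (nbhs y)) => e e0.
near=> z; apply: le_lt_trans (head_coords_dist _ _ _) _.
have : ball y e z by near: z; exact: nbhsx_ballx.
by rewrite -ball_normE.
Unshelve. all: by end_near. Qed.

(** Along a curve in [M] the coordinates of [psi] from index [d] on vanish identically near 0, so by
    the chain rule their derivative is zero. *)
Lemma chart_tangent M xs d (psi : V -> V) h :
  differentiable psi xs ->
  (\forall y \near xs, M y <-> forall i : 'I_n, (d <= i)%N -> psi y 0 i = 0) ->
  tangent_space M xs h -> forall i : 'I_n, (d <= i)%N -> 'D_h psi xs 0 i = 0.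
Proof.
move=> dpsi chart [gam [gam0 Mgam dgam]] i di.
have [dg <-] := dgam.
have diffg : differentiable gam 0 by apply/derivable1_diffP.
have cgam : {for 0, continuous gam} by exact: differentiable_continuous.
have chart0 : \forall t \near (0 : K), psi (gam t) 0 i = 0.
  move: chart; rewrite -gam0 => /cgam chart.
  near=> t; have [+ _] : M (gam t) <-> forall i : 'I_n, (d <= i)%N ->
    psi (gam t) 0 i = 0 by near: t; exact: chart.
  by apply => //; near: t.
have dpsi' : differentiable psi (gam 0) by rewrite gam0.
have : is_derive (0 : K) 1 (fun t => (psi \o gam) t 0 i)
    ('D_('D_1 gam 0) psi xs 0 i).
  have dc : differentiable (psi \o gam) 0 by exact: differentiable_comp.
  apply: is_derive_coord; apply: DeriveDef; first exact: diff_derivable.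
  by rewrite (deriveE _ dc) (diff_comp diffg dpsi') /= gam0 (deriveE _ dpsi)
    (deriveE _ diffg).
move=> [_ <-].
rewrite (near_eq_derive (g := cst 0) (1 : K)) ?derive_cst.
Unshelve. all: by end_near. Qed.

(* The retraction onto M through the chart stands in for the nearest-point
   projection: it moves a point in a direction complementary to the tangent
   space. *)
Lemma chart_retraction M xs : C2_submanifold M xs ->
  exists rho : V -> V, [/\ rho @ xs --> xs, \forall x \near xs, M (rho x) &
    forall (T : Type) (G : set_system T) (X : T -> V) (d0 : V),
      ProperFilter G -> X @ G --> xs -> (\forall t \near G, X t != rho (X t)) ->
      `|X t - rho (X t)|^-1 *: (X t - rho (X t)) @[t --> G] --> d0 ->
      d0 != 0 -> ~ tangent_space M xs d0].
Proof.
move=> [Mxs [d [psi [phi [[C2psi C2phi] phiK psiK chart]]]]].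
have dpsi : \forall y \near xs, differentiable psi y.
  by apply: filterS C2psi => y [].
have dpsi0 := nbhs_singleton dpsi.
have dphi0 : differentiable phi (psi xs).
  by have [] := nbhs_singleton C2phi.
have cpsi : {for xs, continuous psi} by exact: differentiable_continuous.
have cphi : {for psi xs, continuous phi} by exact: differentiable_continuous.
have cdpsi a : {for xs, continuous ('D_a psi)}.
  by apply: differentiable_continuous; have [_ + _] := nbhs_singleton C2psi.
have hd0 : head_coords d (psi xs) = psi xs.
  have [+ _] := nbhs_singleton chart; move=> /(_ Mxs) z.
  apply/rowP => i; rewrite mxE; case: ltnP => // di; exact/esym/z.
(* Project onto the slice R^d x {0} in the chart, then pull back. *)
pose rho x := phi (head_coords d (psi x)).
have cheads : head_coords d (psi x) @[x --> xs] --> psi xs.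
  have := cvg_comp psi _ cpsi (@continuous_head_coords d (psi xs)).
  by rewrite hd0.
have crho : rho @ xs --> xs.
  have := cvg_comp _ phi cheads cphi.
  by rewrite (nbhs_singleton phiK).
have psirho : \forall x \near xs, psi (rho x) = head_coords d (psi x).
  exact: (cheads _ psiK).
exists rho; split => //.
  near=> x; have [_] : M (rho x) <-> forall i : 'I_n, (d <= i)%N ->
      psi (rho x) 0 i = 0 by near: x; exact: (crho _ chart).
  apply => i di; have -> : psi (rho x) = head_coords d (psi x) by near: x.
  by rewrite mxE ltnNge di.
move=> T G X d0 PG XG Xrho Xd d00 tan.
have tail0 := chart_tangent dpsi0 chart tan.
pose D := 'D_d0 psi xs.
pose dir t := `|X t - rho (X t)|^-1 *: (X t - rho (X t)).
have cdir : 'D_(dir t) psi xs @[t --> G] --> D.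
  rewrite /D (deriveE _ dpsi0).
  have -> : (fun t => 'D_(dir t) psi xs) = 'd psi xs \o dir.
    by apply/funext => t; rewrite (deriveE _ dpsi0).
  have H : {for d0, continuous ('d psi xs)} by exact: diff_continuous.
  exact: (cvg_comp dir _ Xd H).
(* From index [d] on, tangency gives zero. Below [d], [psi (X t)] and [psi (rho (X t))] have equal
   coordinates, so strict differentiability makes the derivative along the normalized offset
   arbitrarily small. *)
have D0 (i : 'I_n) : D 0 i = 0.
  case: (ltnP i d) => di; last exact: tail0.
  have Di : ('D_(dir t) psi xs) 0 i @[t --> G] --> D 0 i by exact: cvg_coord cdir.
  apply/eqP; rewrite -normr_le0; apply/ler_addgt0Pr => e e0; rewrite add0r.
  have [dl dl0 strict] := strictly_differentiable dpsi cdpsi e0.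
  apply: (cvgr_to_le (cvg_norm Di)).
  near=> t.
  have Xt : ball xs dl (X t) by near: t; apply: XG; exact: nbhsx_ballx.
  have rXt : ball xs dl (rho (X t)).
    by near: t; apply: (cvg_comp _ _ XG crho); exact: nbhsx_ballx.
  have := strict _ _ Xt rXt.
  have Xne : X t != rho (X t) by near: t.
  have N0 : 0 < `|X t - rho (X t)| by rewrite normr_gt0 subr_eq0.
  have -> : 'D_(dir t) psi xs =
      `|X t - rho (X t)|^-1 *: 'D_(X t - rho (X t)) psi xs.
    by rewrite !deriveE// linearZ.
  rewrite mxE normrM normfV normr_id ler_pdivrMl// mulrC => /(le_trans _); apply.
  apply: le_trans (coord_le_norm _ i); rewrite !mxE.
  have -> : psi (rho (X t)) = head_coords d (psi (X t)).
    by near: t; exact: (XG _ psirho).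
  by rewrite mxE di subrr add0r normrN.
(* The differential of [psi] sends [d0] to 0, and it is injective because [phi \o psi] is the
   identity near [xs]. *)
move: d00; suff -> : d0 = 0 by rewrite eqxx.
have dc : differentiable (phi \o psi) xs by exact: differentiable_comp.
have z0 : 'd psi xs d0 = 0.
  by rewrite -(deriveE _ dpsi0); apply/rowP => i; rewrite [RHS]mxE; exact: D0.
rewrite -[LHS](derive_id xs) -(near_eq_derive (f := phi \o psi) d0)//.
rewrite (deriveE _ dc).
rewrite (diff_comp dpsi0 dphi0).
apply: etrans (congr1 ('d phi (psi xs)) z0) _.
exact: linear0.
Unshelve. all: by end_near. Qed.

End Charts.

(** * Identification of the manifold *)

Section Identification.
Context {K : realType} {n : nat}.
Local Notation V := 'rV[K]_n.
Implicit Types (f : V -> \bar K) (M : set V).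

(** Takes the place of a sequence of counterexamples tending to [x]: along an ultrafilter every
    bounded vector quantity already converges. *)
Lemma not_near_ultra (T : topologicalType) (x : T) (P : set T) :
  ~ nbhs x P -> exists G, [/\ UltraFilter G, nbhs x `<=` G & G (~` P)].
Proof.
move=> nP; have PF : ProperFilter (within (~` P) (nbhs x)).
  apply: Build_ProperFilter => W0; apply: nP.
  by apply: (@filterS _ (nbhs x) _ _ _ _ W0) => y nPy; exact: contrapT.
have [G [UG FG]] := ultraFilterLemma PF.
exists G; split => //; last by apply: FG; exact: (@nearW _ (nbhs x)).
by move=> A xA; apply: FG; apply: (@filterS _ (nbhs x) _ _ _ _ xA).
Qed.

(** The image of an ultrafilter is an ultrafilter, and closed balls are compact. *)
Lemma ultra_bounded_cvg T (G : set_system T) (u : T -> V) (r : K) :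
  UltraFilter G -> (\forall t \near G, `|u t| <= r) -> exists d : V, u @ G --> d.
Proof.
move=> UG ur.
have UuG : UltraFilter (u @ G).
  have PuG : ProperFilter (u @ G) by apply: fmap_proper_filter.
  apply: Build_UltraFilter => H PH uH; rewrite predeqE => A.
  split=> [HA|]; last exact: uH.
  have [//|nA] := in_ultra_setVsetC (u @^-1` A) UG.
  have HnA : H (~` A) by apply: uH.
  have /filter_ex[? []] // : H (A `&` ~` A) by exact: filterI.
have cball : compact [set d : V | `|d| <= r].
  apply: bounded_closed_compact.
    by exists r; split=> [|x rx d /= /le_trans]; [exact: num_real|apply; exact: ltW].
  apply: (@closed_comp _ _ (fun d : V => `|d|) [set x | x <= r]).
    by move=> d _; exact: norm_continuous.
  exact: closed_le.
rewrite compact_ultra in cball.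
by have [d [_ ud]] := cball _ UuG ur; exists d.
Qed.

Lemma ultra_unit_cvg T (G : set_system T) (u : T -> V) : UltraFilter G ->
  (\forall t \near G, `|u t| = 1) -> exists2 d : V, `|d| = 1 & u @ G --> d.
Proof.
move=> UG u1; have [|d ud] := @ultra_bounded_cvg _ G u 1 UG.
  by near=> t; have -> : `|u t| = 1 by near: t.
exists d => //; have cu : `|u t| @[t --> G] --> `|d| by exact: cvg_norm.
by rewrite -(cvg_lim (@Rhausdorff K) cu); apply: (lim_near_cst (@Rhausdorff K)).
Unshelve. all: by end_near. Qed.

Lemma subdiff_fin_num f x u :
  Defs.proper f -> subdiff f x u -> f x \is a fin_num.
Proof.
move=> [f0 [z fz]] /(_ z) xu; rewrite fin_numElt f0 /=.
by move: xu; case: (f x) => [r|//|//]; rewrite ?ltry//; case: (f z) fz.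
Qed.

Lemma subdiff_le f x u y : Defs.proper f -> subdiff f x u ->
  f y \is a fin_num -> fine (f x) + dotp u (y - x) <= fine (f y).
Proof.
move=> pf xu fy; have fx := subdiff_fin_num pf xu.
by rewrite -lee_fin EFinD !fineK.
Qed.

Lemma subdiff_monotone f x y u w : Defs.proper f ->
  subdiff f x u -> subdiff f y w -> 0 <= dotp (u - w) (x - y).
Proof.
move=> pf xu yw.
have := subdiff_le pf xu (subdiff_fin_num pf yw).
have := subdiff_le pf yw (subdiff_fin_num pf xu).
by rewrite -(opprB x y) dotpNr dotpBl; lra.
Qed.

Lemma inner_limit_near f M xs w (e : K) : continuous_rel M (subdiff f) xs ->
  subdiff f xs w -> 0 < e ->
  \forall y \near xs, M y -> exists2 w', subdiff f y w' & ball w e w'.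
Proof.
move=> [_ inner] sw e0.
have H := inner _ sw _ (nbhsx_ballx w e e0).
rewrite /within /= in H; move: H; apply: (@filterS _ (nbhs xs)) => y H My.
by have [w' [yw' bw']] := H My; exists w'.
Qed.

(** Nearness is joint in point and subgradient, so the result serves both for iterates with
    convergent subgradients and for the fixed subgradient [us]. The offset from [M] is measured by
    the chart retraction [rho]. *)
Lemma partly_smooth_identification f M xs us : Defs.proper f ->
  partly_smooth f M xs -> rel_interior (subdiff f xs) us ->
  \forall p \near (xs, us), subdiff f p.1 p.2 -> M p.1.
Proof.
move=> pf [_ [C2M _] tanM contM] ri; apply: contrapT => nH.
have [G [UG Gnbhs Gbad']] := not_near_ultra nH.
pose bad := [set p : V * V | subdiff f p.1 p.2 /\ ~ M p.1].
have Gbad : \forall p \near G, bad p.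
  near=> p; have /not_implyP : ~ (subdiff f p.1 p.2 -> M p.1) by near: p.
  by [].
have cX : (fun p : V * V => p.1) @ G --> xs.
  by move=> A HA; apply: Gnbhs; exact: (cvg_fst HA).
have cU : (fun p : V * V => p.2) @ G --> us.
  by move=> A HA; apply: Gnbhs; exact: (cvg_snd HA).
have [rho [crho Mrho transversal]] := chart_retraction C2M.
have Mrho' : \forall p \near G, M (rho p.1) by exact: (cX _ Mrho).
have Xrho : \forall p \near G, p.1 != rho p.1.
  near=> p; apply/eqP => E; have [_] : bad p by near: p.
  by apply; rewrite E; near: p.
pose dir (p : V * V) := `|p.1 - rho p.1|^-1 *: (p.1 - rho p.1).
have [|d0 d01 cdir] := @ultra_unit_cvg _ G dir UG.
  near=> p; rewrite normrZ normfV normr_id mulVf// normr_eq0 subr_eq0.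
  by near: p.
have d0n : d0 != 0 by rewrite -normr_eq0 d01 oner_neq0.
have := transversal _ G (fun p => p.1) d0 _ cX Xrho cdir d0n.
rewrite tanM => ntan.
(* The tangent space is [Tspace f xs], so a non-tangent [d0] fails to be orthogonal to some parallel
   direction, whose sign can then be chosen. *)
have [nu0 [pnu0 nu0d]] : exists nu0, par (subdiff f xs) nu0 /\ dotp d0 nu0 <> 0.
  apply: contrapT => nex; apply: ntan => nu pnu; apply: contrapT => nud.
  by apply: nex; exists nu.
have [nu pnu nud] : exists2 nu, par (subdiff f xs) nu & 0 < dotp d0 nu.
  have [lt0|gt0|//] := ltrgt0P (dotp d0 nu0); first by exists nu0.
  by exists (- nu0); [exact: parN|rewrite dotpNr oppr_gt0].
have [e e0 sub_e] := rel_interior_par ri pnu.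
pose c := e * dotp d0 nu.
have c0 : 0 < c by rewrite mulr_gt0.
(* With this radius each of the two error terms is at most [n r <= c / 4], while the main term
   exceeds [c / 2]; the factor [n] comes from bounding [dotp] by sup norms. *)
pose r := c / (4 * n.+1%:R).
have r0 : 0 < r by rewrite divr_gt0// mulr_gt0.
have near_w := inner_limit_near contM sub_e r0.
have near_w' : \forall p \near G, exists2 w', subdiff f (rho p.1) w' &
    ball (us + e *: nu) r w'.
  have := cX _ (crho _ near_w) => H.
  near=> p; have : M (rho p.1) by near: p.
  by near: p.
have near_dir : \forall p \near G, c / 2 < e * dotp (dir p) nu.
  have : e * dotp (dir p) nu @[p --> G] --> c.
    by apply: cvgM; [exact: cvg_cst|apply: cvg_dotp => //; exact: cvg_cst].
  by move=> /cvgr_gt; apply; lra.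
have near_u : \forall p \near G, ball us r p.2.
  by apply: cU; exact: nbhsx_ballx.
have [p [[[[[w yw bw] dirp] up] bp] neq]] := filter_ex
  (filterI (filterI (filterI (filterI near_w' near_dir) near_u) Gbad) Xrho).
have N0 : 0 < `|p.1 - rho p.1| by rewrite normr_gt0 subr_eq0.
have dir1 : `|dir p| = 1.
  by rewrite normrZ normfV normr_id mulVf// gt_eqF.
have mono : 0 <= dotp (p.2 - w) (dir p).
  rewrite dotpZr mulr_ge0 ?invr_ge0//.
  by apply: subdiff_monotone => //; case: bp.
have E : dotp (p.2 - w) (dir p) = dotp (p.2 - us) (dir p) +
    dotp (us + e *: nu - w) (dir p) - e * dotp (dir p) nu.
  by rewrite !dotpBl dotpDl dotpZl (dotpC nu); ring.
have B1 := normr_dotp_le (p.2 - us) (dir p).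
have B2 := normr_dotp_le (us + e *: nu - w) (dir p).
rewrite dir1 !mulr1 in B1 B2.
move: up bw; rewrite -!ball_normE /= distrC => up bw.
have nr : n%:R * r <= c / 4.
  rewrite /r mulrA ler_pdivrMr// mulrC.
  have : (n%:R : K) <= n.+1%:R by rewrite ler_nat.
  move: c0; nra.
have n0 : 0 <= (n%:R : K) by [].
have B3 : n%:R * `|p.2 - us| <= n%:R * r by rewrite ler_wpM2l// ltW.
have B4 : n%:R * `|us + e *: nu - w| <= n%:R * r by rewrite ler_wpM2l// ltW.
have A1 := le_trans (ler_norm _) B1.
have A2 := le_trans (ler_norm _) B2.
by move: mono; rewrite E; clear tanM; lra.
Unshelve. all: by end_near. Qed.

End Identification.

(** * Local constancy of the tangent space along an affine manifold *)

Section NormalSharpness.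
Context {K : realType} {n : nat}.
Local Notation V := 'rV[K]_n.
Implicit Types (f : V -> \bar K) (M : set V).

(** The subgradient inequality bounds from below the difference quotients of [f] along [h], which
    are those of [g] for small steps. Applied to [h] and [-h], it fixes the value [dotp w h]. *)
Lemma subdiff_le_derive f (g : V -> K) y h w : Defs.proper f ->
  differentiable g y -> (\forall t \near (0 : K), f (y + t *: h) = (g (y + t *: h))%:E) ->
  subdiff f y w -> dotp w h <= 'D_h g y.
Proof.
move=> pf dg fg yw.
have /is_derive_cvg D : is_derive y h g ('D_h g y).
  exact/derivableP/diff_derivable.
have fgy : f y = (g y)%:E.
  by have := nbhs_singleton fg; rewrite scale0r addr0.
have D' : t^-1 *: (g (t *: h + y) - g y) @[t --> 0^'+] --> 'D_h g y.
  move=> A /D HA.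
  apply: (@filterS _ (nbhs (0 : K)) _ _ _ _ HA) => t At t0.
  by apply: At; rewrite gt_eqF.
apply: (cvgr_to_ge D'); near=> t.
have t0 : 0 < t by near: t; exact: nbhs_right_gt.
have ft : f (y + t *: h) = (g (y + t *: h))%:E.
  by near: t; apply: (@filterS _ (nbhs (0 : K)) _ _ _ _ fg).
have := yw (y + t *: h); rewrite ft fgy -EFinD lee_fin.
rewrite [y + _]addrC addrK dotpZr => H.
by rewrite [leRHS]mulrC ler_pdivlMr// mulrC lerBrDl.
Unshelve. all: by end_near. Qed.

(** A short line through [y] with direction in [Tspace f xs] stays in [M], where [f] agrees with a
    smooth [g]; hence all subgradients at [y] have the same inner product with that direction. *)
Lemma Tspace_sub_near f M xs : Defs.proper f -> C2_along M f xs ->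
  locally_equal xs M (translate xs (Tspace f xs)) ->
  \forall y \near xs, M y -> Tspace f xs `<=` Tspace f y.
Proof.
move=> pf [g C2g fg] loc.
have A : \forall y \near xs, (M y <-> translate xs (Tspace f xs) y) /\
  (M y -> f y = (g y)%:E) by near=> y; split; near: y.
have AA := near_join A.
near=> y; move=> My h Th.
have dg : differentiable g y.
  suff : [/\ differentiable g y, forall a, differentiable ('D_a g) y &
    forall a b, {for y, continuous ('D_b ('D_a g))}] by case.
  by near: y.
have Ay : \forall z \near y, (M z <-> translate xs (Tspace f xs) z) /\
  (M z -> f z = (g z)%:E) by near: y.
have along h' : Tspace f xs h' ->
    \forall t \near (0 : K), f (y + t *: h') = (g (y + t *: h'))%:E.
  move=> Th'.
  have cl : (fun t : K => y + t *: h') @ (0 : K) --> y.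
    rewrite -[X in _ --> X]addr0 -(scale0r h').
    by apply: cvgD; [exact: cvg_cst|apply: cvgZr_tmp; exact: cvg_id].
  have := cl _ Ay.
  apply: (@filterS _ (nbhs (0 : K))) => t [[_ Mt] ft]; apply: ft; apply: Mt.
  rewrite /translate /= addrAC; apply: orthogonalD; last exact: orthogonalZ.
  by have [[+ _] _] := nbhs_singleton Ay; apply.
have eqD w : subdiff f y w -> dotp h w = 'D_h g y.
  move=> yw; apply/eqP; rewrite eq_le dotpC (subdiff_le_derive pf dg (along _ Th) yw).
  have := subdiff_le_derive pf dg (along _ (orthogonalN Th)) yw.
  by rewrite dotpNr !(deriveE _ dg) linearN lerN2.
by apply/orthogonal_parP => w1 w2 /set_mem /eqD -> /set_mem /eqD ->.
Unshelve. all: by end_near. Qed.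

(* The reverse inclusion is where continuity of the subdifferential enters:
   a unit vector of Tspace f y orthogonal to Tspace f xs would have a limit
   lying in Tspace f xs. *)
Lemma Tspace_locally_constant f M xs : Defs.proper f -> partly_smooth f M xs ->
  locally_equal xs M (translate xs (Tspace f xs)) ->
  \forall y \near xs, M y -> Tspace f y = Tspace f xs.
Proof.
move=> pf [_ [_ C2] _ cont] loc.
have sub := Tspace_sub_near pf C2 loc.
apply: contrapT => /not_near_ultra[G [UG Gx Gbad]].
(* Where the inclusion is strict, take a vector of [Tspace f y] outside [Tspace f xs], subtract its
   projection onto [Tspace f xs] and normalize. *)
pose good y := [set u : V | [/\ `|u| = 1, Tspace f y u &
  Defs.orthogonal (Tspace f xs) u]].
have Ggood : \forall y \near G, M y /\ good y !=set0.
  near=> y.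
  have /not_implyP[My neq] : ~ (M y -> Tspace f y = Tspace f xs) by near: y.
  split=> //.
  have sub_y : Tspace f xs `<=` Tspace f y.
    by move: My; near: y; exact: (Gx _ sub).
  have [h Th nTh] : exists2 h, Tspace f y h & ~ Tspace f xs h.
    apply: contrapT => nex; apply: neq; apply/seteqP; split => // h Th.
    by apply: contrapT => nTh; apply: nex; exists h.
  have [p Tp hp] := @orthogonal_projection K n (Tspace f xs) (orthogonal0 (C := _))
    (@orthogonalD _ _ _) (@orthogonalZ _ _ _) h.
  have hp0 : h - p != 0.
    by apply/eqP => /subr0_eq E; apply: nTh; rewrite E.
  exists (`|h - p|^-1 *: (h - p)); split.
  - by rewrite normrZ normfV normr_id mulVf// normr_eq0.
  - by apply/orthogonalZ/orthogonalB => //; exact: sub_y.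
  - exact: orthogonalZ.
pose u y := xget 0 (good y).
have Gu : \forall y \near G, M y /\ good y (u y).
  near=> y; have [My [h gh]] : M y /\ good y !=set0 by near: y.
  by split=> //; exact: (xgetPex 0 (ex_intro _ h gh)).
have [|d d1 cd] := @ultra_unit_cvg _ _ _ G u UG.
  by near=> y; have [_ []] : M y /\ good y (u y) by near: y.
have orth : Defs.orthogonal (Tspace f xs) d.
  move=> h Th; have : dotp (u y) h @[y --> G] --> dotp d h.
    by apply: cvg_dotp => //; exact: cvg_cst.
  move=> cdh; apply/eqP; rewrite eq_le; apply/andP; split.
    apply: (cvgr_to_le cdh); near=> y.
    by have [_ [_ _ ->]] : M y /\ good y (u y) by near: y.
  apply: (cvgr_to_ge cdh); near=> y.
  by have [_ [_ _ ->]] : M y /\ good y (u y) by near: y.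
(* Two subgradients at [xs] are approximated by subgradients at [y], on which [u y] takes equal
   values; in the limit [d] cannot separate the two. *)
have Td : Tspace f xs d.
  apply/orthogonal_parP => w1 w2 /set_mem w1s /set_mem w2s.
  apply/eqP; rewrite -subr_eq0 -dotpBr -normr_le0.
  apply/ler_addgt0Pr => e e0; rewrite add0r.
  have cdw : `|dotp (u y) (w1 - w2)| @[y --> G] --> `|dotp d (w1 - w2)|.
    by apply: cvg_norm; apply: cvg_dotp => //; exact: cvg_cst.
  apply: (cvgr_to_le cdw).
  pose r := e / (2 * n.+1%:R).
  have r0 : 0 < r by rewrite divr_gt0// mulr_gt0.
  have N1 := Gx _ (inner_limit_near cont w1s r0).
  have N2 := Gx _ (inner_limit_near cont w2s r0).
  near=> y.
  have [My [u1 Tu _]] : M y /\ good y (u y) by near: y.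
  have H1 : M y -> exists2 w', subdiff f y w' & ball w1 r w' by near: y.
  have H2 : M y -> exists2 w', subdiff f y w' & ball w2 r w' by near: y.
  have [v1 y1] := H1 My; have [v2 y2] := H2 My; rewrite -!ball_normE /= => b2 b1.
  have uv : dotp (u y) v1 = dotp (u y) v2.
    by move/orthogonal_parP : Tu; apply; exact: mem_set.
  have -> : dotp (u y) (w1 - w2) =
      dotp (u y) (w1 - v1) - dotp (u y) (w2 - v2).
    by rewrite !dotpBr uv; ring.
  have B1 := normr_dotp_le (u y) (w1 - v1).
  have B2 := normr_dotp_le (u y) (w2 - v2).
  rewrite u1 !mul1r in B1 B2.
  apply: le_trans (ler_normB _ _) _; apply: le_trans (lerD B1 B2) _.
  rewrite -mulrDr; apply: (@le_trans _ _ (n%:R * (r + r))).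
    by rewrite ler_wpM2l// ltW// ltrD.
  suff nr : n%:R * r <= e / 2 by rewrite mulrDr [leRHS]splitr lerD.
  rewrite /r mulrA ler_pdivrMr ?mulr_gt0//.
  have -> : e / 2 * (2 * n.+1%:R) = n.+1%:R * e by field.
  by rewrite ler_wpM2r ?(ltW e0)// ler_nat.
have := orth _ Td => /dotp_eq0 d0.
by move: d1; rewrite d0 normr0 => /eqP; rewrite eq_sym oner_eq0.
Unshelve. all: by end_near. Qed.

End NormalSharpness.

(** * Epigraph cones and relatively interior subgradients *)

Section LocallyPolyhedral.
Context {K : realType} {n : nat}.
Local Notation V := 'rV[K]_n.
Implicit Types (f : V -> \bar K) (M C : set V) (xs us z h u w y : V) (r s d : K).

(* A is the epigraph of the directional derivative of f at xs: the cone cut out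
   by the constraints active at (xs, f xs). *)
Definition local_epigraph_cone f xs (A : V -> K -> Prop) d :=
  [/\ forall s z r, 0 < s -> A z r -> A (s *: z) (s * r),
    forall T (G : set_system T) (Z : T -> V) (rho : T -> K) z r,
      ProperFilter G -> Z @ G --> z -> rho @ G --> r ->
      (\forall t \near G, A (Z t) (rho t)) -> A z r,
    forall z r, `|z| < d -> (f (xs + z)%R <= (fine (f xs) + r)%R%:E)%E -> A z r &
    forall z r, `|z| < d -> - d <= r -> A z r ->
      (f (xs + z)%R <= (fine (f xs) + r)%R%:E)%E].

(** Constraints active at [(xs, f xs)] become homogeneous after translation; an inactive one has
    positive slack and holds for all small [z]. The height [r] is bounded only from below because
    its coefficients [b i] are nonpositive. *)
Lemma locally_polyhedral_cone f xs : f xs \is a fin_num ->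
  locally_polyhedral f xs ->
  exists A, exists2 d, 0 < d & local_epigraph_cone f xs A d.
Proof.
move=> fxs [g [p [a [b [c epi]]]]] fg.
set t0 := fine (f xs).
have gxs : (g xs <= t0%:E)%E by rewrite -(nbhs_singleton fg) /t0 fineK.
pose sl i := c i - (dotp (a i) xs + b i * t0).
have sl0 i : 0 <= sl i by rewrite subr_ge0; exact: (epi xs t0).1.
(* An epigraph is closed upwards: were [b i] positive, [(xs, t0)] raised by [(sl i + 1) / b i] would
   stay in it yet violate constraint [i] by 1. *)
have b0 i : b i <= 0.
  rewrite leNgt; apply/negP => bi.
  have : (g xs <= (t0 + (sl i + 1) / b i)%R%:E)%E.
    apply: le_trans gxs _; rewrite lee_fin lerDl divr_ge0 ?(ltW bi)//.
    by rewrite addr_ge0.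
  move/epi/(_ i).
  have -> : dotp (a i) xs + b i * (t0 + (sl i + 1) / b i) = c i + 1.
    by rewrite /sl; field; rewrite gt_eqF.
  by rewrite gerDl ler10.
pose A z r := forall i, sl i = 0 -> dotp (a i) z + b i * r <= 0.
have [d0 d00 fg'] : exists2 d, 0 < d & forall z, `|z| < d -> f (xs + z) = g (xs + z).
  move: fg => /nbhs_ballP[d /= d_0 H]; exists d => // z zd; apply: H.
  by rewrite -ball_normE /= opprD addNKr normrN.
have epiz z r : `|z| < d0 -> (f (xs + z)%R <= (t0 + r)%R%:E)%E <->
    forall i, dotp (a i) z + b i * r <= sl i.
  move=> zd; rewrite fg'//; apply: (iff_trans (epi _ _)).
  by split=> H i; have := H i; rewrite /sl dotpDr; lra.
(* For [|z| < d] and [- d <= r] the left side of constraint [i] is at most [(n |a i| - b i) d],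
   which must not exceed the slack. *)
have [d d_0 [dd0 dsl]] : exists2 d, 0 < d & d <= d0 /\
    forall i, 0 < sl i -> (n%:R * `|a i| + - b i) * d <= sl i.
  have : \forall d \near 0^'+, d <= d0 /\
      forall i, 0 < sl i -> (n%:R * `|a i| + - b i) * d <= sl i.
    near=> d; split; first by near: d; exact: nbhs_right_le.
    near: d; apply: filter_forall => i.
    have [->|nsi] := eqVneq (sl i) 0; first by near=> d; rewrite ltxx.
    have sli : 0 < sl i by rewrite lt_neqAle eq_sym nsi sl0.
    pose k := n%:R * `|a i| + - b i.
    have k0 : 0 <= k by rewrite addr_ge0 ?mulr_ge0// oppr_ge0.
    near=> d => _.
    have d_0 : 0 < d by [].
    have : d <= sl i / (k + 1).
      near: d; apply: nbhs_right_le.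
      by rewrite divr_gt0// ltr_wpDl.
    rewrite ler_pdivlMr ?ltr_wpDl// -/k => H; apply: le_trans H.
    by rewrite mulrC ler_wpM2l ?(ltW d_0)// lerDl.
  move=> H; near (0 : K)^'+ => d; exists d; first by [].
  by near: d; exact: H.
exists A, d => //; split.
- move=> s z r s0 Azr i si; rewrite dotpZr mulrCA -mulrDr.
  by rewrite pmulr_rle0//; exact: Azr.
- move=> T G Z rho z r PG Zz rr AZ i si.
  have cl : dotp (a i) (Z t) + b i * rho t @[t --> G] --> dotp (a i) z + b i * r.
    apply: cvgD; first by apply: cvg_dotp => //; exact: cvg_cst.
    by apply: cvgM => //; exact: cvg_cst.
  apply: (cvgr_to_le cl); near=> t.
  have AZt : A (Z t) (rho t) by near: t.
  exact: AZt.
- move=> z r zd /epiz H i si; rewrite -si; apply: H.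
  exact: lt_le_trans zd dd0.
- move=> z r zd dr Azr; apply/epiz; first exact: lt_le_trans zd dd0.
  move=> i; have := sl0 i; rewrite le_eqVlt => /orP[/eqP si|si].
    by rewrite -si; exact: Azr.
  apply: le_trans (dsl i si); rewrite mulrDl lerD//.
    apply: le_trans (ler_norm _) _; apply: le_trans (normr_dotp_le _ _) _.
    by rewrite mulrA ler_wpM2l ?mulr_ge0// ltW.
  by rewrite mulNr -mulrN ler_wnM2l.
Unshelve. all: by end_near. Qed.

(** Passes from the Euclidean ball of [rel_interior] to a sup-norm ball; the squared Euclidean norm
    is at most [n] times the squared sup norm. *)
Lemma rel_interior_ball C us : rel_interior C us ->
  exists2 e : K, 0 < e & forall y, affine_hull C y -> `|y - us| < e -> C y.
Proof.
move=> [_ [e e0 H]]; exists (e / n.+1%:R); first by rewrite divr_gt0.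
move=> y Cy yd; apply: H => //.
rewrite -(@ltr_pXn2r _ 2)// ?nnegrE ?enorm_ge0 ?(ltW e0)// sqr_enorm.
have := ler_norm (dotp (y - us) (y - us)).
move=> /le_trans/(_ (normr_dotp_le _ _)) /le_lt_trans; apply.
move: yd; rewrite ltr_pdivlMr// => yd.
have [->|ne] := eqVneq `|y - us| 0; first by rewrite !mulr0 exprn_gt0.
have gt0 : 0 < `|y - us| by rewrite lt_neqAle eq_sym ne normr_ge0.
have n1 : (1 : K) <= n.+1%:R by rewrite ler1n.
have nn : (n%:R : K) <= n.+1%:R by rewrite ler_nat.
apply: (@le_lt_trans _ _ ((`|y - us| * n.+1%:R) ^+ 2)); last first.
  by rewrite ltr_pXn2r// nnegrE ?mulr_ge0// ltW.
rewrite exprMn mulrC -expr2 ler_wpM2l ?sqr_ge0//.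
apply: le_trans nn _; rewrite expr2.
by rewrite ler_peMl.
Qed.

(** A point [w] of [C] near [us] can move within [C] both ways along every parallel direction, so a
    linear functional maximal at [w] is constant on [C]. *)
Lemma rel_interior_normal C us : rel_interior C us ->
  \forall w \near us, C w -> forall z,
    (forall u, C u -> dotp u z <= dotp w z) -> Defs.orthogonal (par C) z.
Proof.
move=> /rel_interior_ball[e e0 He].
apply/nbhs_ballP; exists (e / 2); first by rewrite /= divr_gt0.
move=> w; rewrite -ball_normE /= distrC => wd Cw z zmax.
have le0 nu : par C nu -> dotp nu z <= 0.
  (* Half of [e] covers the distance from [w] to [us], the other half the step along [nu]. *)
  move=> pnu; pose s := e / 2 / (`|nu| + 1).
  have N1 : 0 < `|nu| + 1 by rewrite ltr_wpDl.
  have s0 : 0 < s by rewrite !divr_gt0.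
  have Cs : C (w + s *: nu).
    apply: He; first by apply: affine_hull_par pnu; exact: sub_affine_hull.
    rewrite addrAC; apply: le_lt_trans (ler_normD _ _) _.
    rewrite [ltRHS]splitr ltr_leD// normrZ gtr0_norm// /s.
    by rewrite mulrAC ler_pdivrMr// ler_wpM2l ?lerDl// divr_ge0// ltW.
  have := zmax _ Cs; rewrite dotpDl dotpZl gerDl.
  by rewrite pmulr_rle0.
move=> nu pnu; apply/eqP; rewrite dotpC eq_le le0//=.
by have := le0 _ (parN pnu); rewrite dotpNl oppr_le0.
Qed.

End LocallyPolyhedral.

(** * The manifold of a locally polyhedral function *)

Section PolyhedralManifold.
Context {K : realType} {n : nat}.
Local Notation V := 'rV[K]_n.
Implicit Types (f : V -> \bar K) (M : set V) (xs us z h u w y : V) (r s d : K).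

Lemma near_norm_lt xs d : 0 < d -> \forall y \near xs, `|y - xs| < d.
Proof.
move=> d0; apply/nbhs_ballP; exists d => // y.
by rewrite -ball_normE /= distrC.
Qed.

(** With [z = y - xs], homogeneity of the cone bounds [f (xs + 2 z)] by [f xs + 2 (f y - f xs)].
    Testing the subgradient [w] at [xs] and at [xs + 2 z] forces [dotp w z = f y - f xs], so the
    affine support at [y] passes through [(xs, f xs)]. *)
Lemma cone_subdiff f xs us A d : Defs.proper f -> 0 < d ->
  local_epigraph_cone f xs A d -> subdiff f xs us ->
  \forall y \near xs, forall w, subdiff f y w ->
    [/\ subdiff f xs w, fine (f y) = fine (f xs) + dotp w (y - xs) &
        A (y - xs) (dotp w (y - xs))].
Proof.
move=> pf d0 [hom _ fA Af] xus.
have fxs := subdiff_fin_num pf xus.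
pose k := n%:R * `|us| + 1.
have k0 : 0 < k by rewrite ltr_wpDl// mulr_ge0.
near=> y => w yw.
have : `|y - xs| < d / 2 by near: y; apply: near_norm_lt; rewrite divr_gt0.
have : `|y - xs| < d / 2 / k by near: y; apply: near_norm_lt; rewrite !divr_gt0.
set z := y - xs => zk z2.
have fy := subdiff_fin_num pf yw.
have yE : y = xs + z by rewrite subrKC.
pose r := fine (f y) - fine (f xs).
have usz : dotp us z <= r.
  by rewrite /r lerBrDl; exact: subdiff_le.
have wz : r <= dotp w z.
  have := subdiff_le pf yw fxs.
  by rewrite -(opprB y xs) dotpNr -/z /r; lra.
have Azr : A z r.
  apply: fA; first by apply: lt_trans z2 _; rewrite ltr_pdivrMr// ltr_pMr// ltr1n.
  by rewrite -yE /r subrKC fineK.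
have f2 : (f (xs + 2 *: z)%R <= (fine (f xs) + 2 * r)%R%:E)%E.
  apply: Af; last by apply: hom.
    by rewrite normrZ gtr0_norm// mulrC -ltr_pdivlMr.
  (* Since [dotp us z <= r], this keeps the doubled height [2 r] at least [- d], as the last cone
     property requires. *)
  have : - dotp us z <= d / 2.
    apply: le_trans (ler_norm _) _; rewrite normrN.
    apply: le_trans (normr_dotp_le _ _) _; rewrite mulrA.
    apply: (@le_trans _ _ (k * `|z|)); first by rewrite ler_wpM2r// lerDl.
    by rewrite mulrC -ler_pdivlMr// ltW.
  by move: usz; lra.
have f2fin : f (xs + 2 *: z) \is a fin_num.
  by rewrite fin_numElt pf.1 /= (le_lt_trans f2) ?ltry.
have wr : dotp w z <= r.
  have := subdiff_le pf yw f2fin.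
  have -> : xs + 2 *: z - y = z by apply/rowP => i; rewrite yE !mxE; ring.
  move: f2; rewrite -[X in (X <= _)%E]fineK// lee_fin /r; lra.
have rE : r = dotp w z by apply/eqP; rewrite eq_le wz wr.
split; last by rewrite -rE.
  move=> v; have := yw v; apply: le_trans.
  rewrite -[f xs]fineK// -[f y]fineK// -!EFinD lee_fin.
  have -> : v - xs = v - y + z by apply/rowP => i; rewrite yE !mxE; ring.
  by rewrite dotpDr -rE /r; lra.
by rewrite -rE /r subrKC.
Unshelve. all: by end_near. Qed.

(** Inner semicontinuity gives a subgradient [w] at [y] close to [us]. By [cone_subdiff] it
    maximizes the inner product with [y - xs] over the subdifferential at [xs], so
    [rel_interior_normal] applies and [w] may be replaced by [us]. *)
Lemma polyhedral_manifold_near f M xs us A d : Defs.proper f -> 0 < d ->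
  local_epigraph_cone f xs A d -> continuous_rel M (subdiff f) xs ->
  rel_interior (subdiff f xs) us ->
  \forall y \near xs, M y -> [/\ Tspace f xs (y - xs),
    f y = (fine (f xs) + dotp us (y - xs))%:E & A (y - xs) (dotp us (y - xs))].
Proof.
move=> pf d0 cone cont ri; have [xus _] := ri.
have [e /= e0 ne] := (nbhs_ballP _ _).1 (rel_interior_normal ri).
have cs := cone_subdiff pf d0 cone xus.
near=> y => My.
have [w yw bw] : exists2 w, subdiff f y w & ball us e w.
  by move: My; near: y; exact: inner_limit_near.
have [xw fy Aw] : [/\ subdiff f xs w, fine (f y) = fine (f xs) + dotp w (y - xs) &
    A (y - xs) (dotp w (y - xs))] by move: w yw {bw}; near: y.
have Ty : Tspace f xs (y - xs).
  apply: (ne w bw xw) => u xu.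
  have := subdiff_le pf xu (subdiff_fin_num pf yw).
  by rewrite fy lerD2l.
have E : dotp w (y - xs) = dotp us (y - xs).
  rewrite !(dotpC _ (y - xs)).
  by move/orthogonal_parP: Ty; apply; exact: mem_set.
split=> //; last by rewrite -E.
by rewrite -E -fy fineK//; exact: subdiff_fin_num yw.
Unshelve. all: by end_near. Qed.

(** The difference quotients of a curve in [M] lie in the cone by homogeneity, and the cone is
    closed. *)
Lemma polyhedral_tangent_cone f M xs us A d h : Defs.proper f -> 0 < d ->
  local_epigraph_cone f xs A d -> continuous_rel M (subdiff f) xs ->
  rel_interior (subdiff f xs) us -> tangent_space M xs h -> A h (dotp us h).
Proof.
move=> pf d0 cone cont ri [gam [gam0 Mgam dgam]].
have near_M := polyhedral_manifold_near pf d0 cone cont ri.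
have [hom clA _ _] := cone.
have cgam : gam @ (0 : K) --> xs.
  rewrite -gam0; apply: differentiable_continuous.
  by apply/derivable1_diffP; have [] := dgam.
have /is_derive_cvg cq := dgam.
have sub0 (P : set K) : nbhs (0 : K) P -> \forall t \near (0 : K)^'+, P t.
  by move=> H; apply: (@filterS _ (nbhs (0 : K)) _ _ _ _ H).
pose q t := t^-1 *: (gam t - xs).
have cq' : q @ (0 : K)^'+ --> h.
  have H : t^-1 *: (gam (t *: 1 + 0) - gam 0) @[t --> (0 : K)^'+] --> h.
    move=> P /cq HP.
    apply: (@filterS _ (nbhs (0 : K)) _ _ _ _ HP) => t Pt t0.
    by apply: Pt; rewrite gt_eqF.
  apply: cvg_trans H; apply: near_eq_cvg; near=> t.
  by rewrite /q gam0 addr0 [t *: 1]mulr1.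
apply: (clA _ ((0 : K)^'+) q (fun t => dotp us (q t))) => //.
  by apply: cvg_dotp => //; exact: cvg_cst.
near=> t.
have t0 : 0 < t by [].
rewrite dotpZr; apply: hom; first by rewrite invr_gt0.
have Mt : M (gam t) by near: t; exact: sub0.
suff [] : [/\ Tspace f xs (gam t - xs),
  f (gam t) = (fine (f xs) + dotp us (gam t - xs))%:E &
  A (gam t - xs) (dotp us (gam t - xs))] by [].
by move: Mt; near: t; apply: sub0; exact: (cgam _ near_M).
Unshelve. all: by end_near. Qed.

(** Only the inclusion of [xs + T] in [M] is new. Vectors of [T] are tangent, so the cone property
    puts [f] near [xs] below the affine support of slope [us]; hence [us] is a subgradient at [y],
    and identification places [y] in [M]. *)
Lemma polyhedral_manifold_affine f M xs us : Defs.proper f ->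
  partly_smooth f M xs -> rel_interior (subdiff f xs) us ->
  locally_polyhedral f xs ->
  locally_equal xs M (translate xs (Tspace f xs)) /\
  \forall y \near xs, M y -> f y = (fine (f xs) + dotp us (y - xs))%:E.
Proof.
move=> pf ps ri lp; have [_ _ tanM cont] := ps; have [xus _] := ri.
have fxs := subdiff_fin_num pf xus.
have [A [d d0 cone]] := locally_polyhedral_cone fxs lp.
have near_M := polyhedral_manifold_near pf d0 cone cont ri.
have idM := partly_smooth_identification pf ps ri.
split; last first.
  by near=> y => My; suff [] : [/\ Tspace f xs (y - xs),
    f y = (fine (f xs) + dotp us (y - xs))%:E & A (y - xs) (dotp us (y - xs))];
    [|move: My; near: y].
have idM' : \forall y \near xs, subdiff f y us -> M y.
  have [[P Q] /= [xP usQ] PQ] := idM.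
  apply: (@filterS _ (nbhs xs) _ _ _ _ xP) => y Py.
  by apply: (PQ (y, us)); split=> //=; exact: nbhs_singleton usQ.
pose k := n%:R * `|us| + 1.
have k0 : 0 < k by rewrite ltr_wpDl// mulr_ge0.
rewrite /locally_equal; near=> y; split=> [My|Ty].
  suff [] : [/\ Tspace f xs (y - xs),
    f y = (fine (f xs) + dotp us (y - xs))%:E & A (y - xs) (dotp us (y - xs))] by [].
  by move: My; near: y.
suff : subdiff f y us by near: y.
have yd : `|y - xs| < d by near: y; exact: near_norm_lt.
have yk : `|y - xs| < d / k by near: y; apply: near_norm_lt; rewrite divr_gt0.
have Ah : A (y - xs) (dotp us (y - xs)).
  by apply: (polyhedral_tangent_cone pf d0 cone cont ri); rewrite tanM.
have [_ _ _ Af] := cone.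
have fy : (f y <= (fine (f xs) + dotp us (y - xs))%:E)%E.
  rewrite -[y in f y](subrKC xs); apply: Af => //.
  rewrite lerNl; apply: le_trans (ler_norm _) _; rewrite normrN.
  apply: le_trans (normr_dotp_le _ _) _; rewrite mulrA.
  apply: (@le_trans _ _ (k * `|y - xs|)); first by rewrite ler_wpM2r// lerDl.
  by rewrite mulrC -ler_pdivlMr// ltW.
move=> v; apply: le_trans (leeD2r _ fy) _; apply: le_trans (xus v).
rewrite -[X in (_ <= X + _)%E]fineK// -!EFinD lee_fin -addrA lerD2l -dotpDr.
by rewrite addrC subrKA.
Unshelve. all: by end_near. Qed.

End PolyhedralManifold.

(** * Riemannian derivatives on a locally affine manifold *)

Section AffineManifold.
Context {K : realType} {n : nat}.
Local Notation V := 'rV[K]_n.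
Implicit Types (f : V -> \bar K) (M : set V) (xs us h y : V).

Lemma cvg_line y h : (fun t : K => y + t *: h) @ (0 : K) --> y.
Proof.
rewrite -[X in _ --> X]addr0 -(scale0r h).
by apply: cvgD; [exact: cvg_cst|apply: cvgZr_tmp; exact: cvg_id].
Qed.

(** The point [y] competes at distance 0, so whatever nearest point [proj] selects must be [y]. *)
Lemma proj_id M y : M y -> Defs.proj M y = y.
Proof.
move=> My; have Hy : [set z | M z /\ forall w, M w ->
    enorm (y - z) <= enorm (y - w)] y.
  by split=> // w _; rewrite subrr enorm0 enorm_ge0.
have [_ /(_ _ My)] := xgetPex 0 (ex_intro _ y Hy).
by rewrite subrr enorm0 => /enorm_le0/subr0_eq/esym.
Qed.

Lemma tangent_space_affine f M xs :
  locally_equal xs M (translate xs (Tspace f xs)) ->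
  \forall y \near xs, M y -> tangent_space M y = Tspace f xs /\
    forall h, Tspace f xs h -> \forall t \near (0 : K), M (y + t *: h).
Proof.
(* The description of [M] is needed on a neighbourhood of each nearby [y], not only of [xs]. *)
move=> loc; have loc2 := near_join loc.
near=> y => My.
have locy : \forall z \near y, M z <-> translate xs (Tspace f xs) z by near: y.
have Ty : Tspace f xs (y - xs) by apply/(nbhs_singleton locy).
have line h : Tspace f xs h -> \forall t \near (0 : K), M (y + t *: h).
  move=> Th; have := @cvg_line y h _ locy.
  apply: (@filterS _ (nbhs (0 : K))) => t [_]; apply.
  by rewrite /translate /= addrAC; apply: orthogonalD => //; exact: orthogonalZ.
split=> //; apply/seteqP; split=> h.
  move=> [gam [gam0 Mgam dgam]] u pu.
  have cgam : gam @ (0 : K) --> y.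
    rewrite -gam0; apply: differentiable_continuous.
    by apply/derivable1_diffP; have [] := dgam.
  have /is_derive_cvg cq := dgam.
  have cqu : dotp (t^-1 *: (gam (t *: 1 + 0) - gam 0)) u @[t --> (0 : K)^'] -->
      dotp h u by apply: cvg_dotp => //; exact: cvg_cst.
  rewrite -(cvg_lim (@Rhausdorff K) cqu).
  apply: (cvg_lim (@Rhausdorff K)); apply: cvg_near_cst.
  have near0 : \forall t \near (0 : K), dotp (gam t - y) u = 0.
    have Ng := cgam _ locy.
    near=> t; have Mt : M (gam t) by near: t.
    have [+ _] : M (gam t) <-> translate xs (Tspace f xs) (gam t) by near: t.
    move=> /(_ Mt) Tt.
    have -> : gam t - y = (gam t - xs) - (y - xs) by rewrite opprB subrKA.
    by rewrite dotpBl Tt// Ty// subrr.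
  apply: (@filterS _ (nbhs (0 : K)) _ _ _ _ near0) => t t0 _.
  by rewrite /= gam0 addr0 [t *: 1]mulr1 dotpZl t0 mulr0.
move=> Th; exists (fun t => y + t *: h); split.
- by rewrite scale0r addr0.
- exact: line.
- have := @is_derive_line K _ _ (@id V) y h 0.
  by rewrite derive_id; apply; exact: ex_diff.
Unshelve. all: by end_near. Qed.

Lemma is_derive_affine (a b t : K) : is_derive t 1 (fun s : K => a + s * b) b.
Proof.
apply/is_derive_cvg; apply: cvg_near_cst; near=> s.
have s0 : s != 0 by near: s; exact: nbhs_dnbhs_neq.
rewrite /GRing.scale /=; field.
Unshelve. all: by end_near. Qed.

(** Short tangent segments stay in [M], so [f] along their projection is affine with slope
    [dotp us h]. The gradient is the projection of [us] onto the tangent space, the same vector for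
    every [y]. *)
Lemma riemannian_affine f M xs us (c : K) :
  locally_equal xs M (translate xs (Tspace f xs)) ->
  (\forall y \near xs, M y -> f y = (c + dotp us (y - xs))%:E) ->
  exists g, \forall y \near xs, M y -> is_riem_grad M f y g /\ is_riem_hess M f y 0.
Proof.
move=> loc faff.
have [g Tg usg] := @orthogonal_projection K n (Tspace f xs) (orthogonal0 (C := _))
    (@orthogonalD _ _ _) (@orthogonalZ _ _ _) us.
exists g.
have tan := tangent_space_affine loc.
have faff2 := near_join faff.
near=> y => My.
have [TE line] : tangent_space M y = Tspace f xs /\
  forall h, Tspace f xs h -> \forall t \near (0 : K), M (y + t *: h).
  by move: My; near: y.
have fy : \forall z \near y, M z -> f z = (c + dotp us (z - xs))%:E by near: y.
have along h : Tspace f xs h -> \forall t \near (0 : K),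
    along_proj M f y h t = c + dotp us (y - xs) + t * dotp g h.
  move=> Th; have Mt := line h Th; have ft := @cvg_line y h _ fy.
  near=> t; have Myt : M (y + t *: h) by near: t.
  rewrite /along_proj proj_id//.
  have -> : f (y + t *: h) = (c + dotp us (y + t *: h - xs))%:E.
    by move: Myt; near: t.
  have -> : dotp g h = dotp us h.
    by apply/esym/eqP; rewrite -subr_eq0 -dotpBl; apply/eqP/usg.
  by rewrite /= (addrAC y) [in LHS]dotpDr dotpZr addrA.
have dalong h : Tspace f xs h -> \forall t \near (0 : K),
    is_derive (t : K) (1 : K) (along_proj M f y h) (dotp g h).
  move=> /along/near_join; apply: (@filterS _ (nbhs (0 : K))) => t Et.
  apply: near_eq_is_derive (is_derive_affine (c + dotp us (y - xs)) _ t).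
  by apply: (@filterS _ (nbhs t) _ _ _ _ Et).
split; first by split; rewrite TE// => h /dalong/nbhs_singleton.
split; rewrite TE.
- by move=> h _; rewrite mulmx0; exact: orthogonal0.
- by move=> h h' _ _; rewrite !mulmx0 dotp0l dotp0r.
- move=> h Th; split.
    by apply: (@filterS _ (nbhs (0 : K)) _ _ _ _ (dalong h Th)) => t [].
  rewrite mulmx0 dotp0l.
  apply: near_eq_is_derive (is_derive_cst (dotp g h) _ _).
  apply: (@filterS _ (nbhs (0 : K)) _ _ _ _ (dalong h Th)) => t [_ <-].
  by rewrite derive1E.
Unshelve. all: by end_near. Qed.

End AffineManifold.

(** * Proximal points and conjugates *)

Section ConvexAnalysis.
Context {K : realType} {n : nat}.
Local Notation V := 'rV[K]_n.
Implicit Types (f : V -> \bar K) (x y p q u v w : V).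

(** Final step of arguments that move along a segment, divide by its parameter and let it tend to
    0. *)
Lemma ge0_small_perturbation (c d : K) :
  (forall t : K, 0 < t -> t < 1 -> 0 <= c + t * d) -> 0 <= c.
Proof.
move=> H; have cl : c + t * d @[t --> (0 : K)^'+] --> c.
  have : c + t * d @[t --> (0 : K)] --> c + 0 * d.
    apply: cvgD; first exact: cvg_cst.
    by apply: cvgM; [exact: cvg_id|exact: cvg_cst].
  by rewrite mul0r addr0; exact: cvg_at_right_filter.
apply: (cvgr_to_ge cl); near=> t; exact: H.
Unshelve. all: by end_near. Qed.

Lemma dotp_sqrD x y (t : K) :
  dotp (x + t *: y) (x + t *: y) = dotp x x + 2 * t * dotp x y + t ^+ 2 * dotp y y.
Proof. by rewrite !dotpDl !dotpDr !dotpZl !dotpZr (dotpC y x); ring. Qed.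

(** Compare [p] with [p + t (y - p)] using convexity of [f]: the terms of first order in [t] give
    the subgradient inequality. *)
Lemma prox_subdiff (g : K) f x p : 0 < g -> Defs.proper f -> econvex f ->
  prox g f x p -> subdiff f p (g^-1 *: (x - p)).
Proof.
move=> g0 [f0 [z fz]] cf pr.
have fin y : (f y < +oo)%E -> f y \is a fin_num by rewrite fin_numElt f0.
have fp : f p \is a fin_num.
  apply: (fin p); rewrite ltey; apply/eqP => fp; have := pr z.
  rewrite fp gt0_muley ?lte_fin// addey// -(fineK (fin z fz)) -EFinM -EFinD.
  by rewrite leye_eq.
move=> y; have [fy|] := ltP (f y) +oo%E; last by rewrite leye_eq => /eqP ->; rewrite leey.
have fy' := fin y fy.
rewrite -(fineK fp) -(fineK fy') -EFinD lee_fin.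
set a := fine (f p); set b := fine (f y).
suff H : 0 <= dotp (p - x) (y - p) + g * (b - a).
  rewrite dotpZl -(opprB p x) dotpNl -subr_ge0.
  rewrite -(pmulr_rge0 _ g0) mulrBr mulrDr mulrA mulfV ?gt_eqF// mul1r.
  by move: H; lra.
apply: (@ge0_small_perturbation _ (dotp (y - p) (y - p) / 2)) => t t0 t1.
have cz : (f (t *: y + (1 - t) *: p)%R <= (t * b + (1 - t) * a)%R%:E)%E.
  by apply: le_trans (cf _ _ _ t0 t1) _; rewrite [leRHS]EFinD !EFinM /a /b !fineK.
have := pr (t *: y + (1 - t) *: p).
rewrite -(fineK fp) -/a -EFinM -EFinD => H.
have : (2^-1 * enorm (p - x) ^+ 2 + g * a <=
    2^-1 * enorm (t *: y + (1 - t) *: p - x) ^+ 2 + g * (t * b + (1 - t) * a)).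
  rewrite -lee_fin; apply: le_trans H _; rewrite [in leRHS]EFinD leeD2l//.
  by rewrite EFinM lee_wpmul2l// lee_fin ltW.
rewrite !sqr_enorm.
have -> : t *: y + (1 - t) *: p - x = (p - x) + t *: (y - p).
  by apply/rowP => i; rewrite !mxE; ring.
rewrite dotp_sqrD => {}H; rewrite -(pmulr_rge0 _ t0).
move: H; move: (dotp (p - x) (y - p)) (dotp (p - x) (p - x)) (dotp (y - p) (y - p)).
move=> A B C H.
lra.
Unshelve. all: by end_near. Qed.

Lemma conjugate_ge f u x : ((dotp u x)%:E - f x <= conjugate f u)%E.
Proof. by apply: ereal_sup_ubound; exists x. Qed.

Lemma econvex_conjugate f : (forall x, (-oo < f x)%E) -> econvex (conjugate f).
Proof.
move=> f0 u w t t0 t1; apply: ge_ereal_sup => _ [x _ <-].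
have t1' : 0 < 1 - t by rewrite subr_gt0.
have := conjugate_ge f u x; have := conjugate_ge f w x.
case: (f x) (f0 x) => [r _| |//]; last by move=> _ _ _; rewrite leNye.
move=> Hw Hu.
have -> : ((dotp (t *: u + (1 - t) *: w)%R x)%:E - r%:E =
  t%:E * ((dotp u x)%:E - r%:E) + (1 - t)%R%:E * ((dotp w x)%:E - r%:E))%E.
  rewrite -!EFinB -!EFinM -EFinD dotpDl !dotpZl; congr EFin; ring.
by apply: leeD; rewrite lee_wpmul2l// lee_fin ltW.
Qed.

(** Equality case of the Fenchel-Young inequality. *)
Lemma conjugate_subdiff f y w : subdiff f y w ->
  conjugate f w = ((dotp w y)%:E - f y)%E.
Proof.
move=> yw; apply/eqP; rewrite eq_le conjugate_ge andbT.
apply: ge_ereal_sup => _ [x _ <-]; have := yw x; rewrite dotpBr EFinB.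
case: (f y) => [r| |]; case: (f x) => [s| |]; rewrite ?leey ?leNye//=.
by rewrite -!EFinB -EFinD !lee_fin; lra.
Qed.

Lemma proper_conjugate f y w : Defs.proper f -> subdiff f y w ->
  Defs.proper (conjugate f).
Proof.
move=> pf yw; have fy := subdiff_fin_num pf yw; split.
  move=> u; apply: lt_le_trans (conjugate_ge f u y).
  by rewrite -(fineK fy) -EFinB ltNyr.
by exists w; rewrite (conjugate_subdiff yw) -(fineK fy) -EFinB ltry.
Qed.

End ConvexAnalysis.

(** * Strong convexity and the gradient of the conjugate *)

Section StrongConvexity.
Context {K : realType} {n : nat}.
Local Notation V := 'rV[K]_n.
Implicit Types (f : V -> \bar K) (x y p q u v w : V).

Lemma cvg_rowP m T (G : set_system T) {FG : Filter G} (X : T -> 'rV[K]_m)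
    (x : 'rV[K]_m) :
  (forall i, X t 0 i @[t --> G] --> x 0 i) -> X @ G --> x.
Proof.
move=> Xi; apply/cvgrPdist_le => e e0.
have H : \forall t \near G, forall i, `|x 0 i - X t 0 i| <= e.
  apply: filter_forall => i.
  by have /cvgrPdist_le := Xi i; apply.
near=> t; apply: norm_le_coord => [|i]; first exact: ltW.
have : forall i, `|x 0 i - X t 0 i| <= e by near: t.
by move=> /(_ i); rewrite !mxE.
Unshelve. all: by end_near. Qed.

(** Carries Euclidean Lipschitz bounds, in squared form, over to the sup-norm topology. *)
Lemma dotp_lipschitz_continuous m (E : V -> 'rV[K]_m) (c : K) :
  (forall x y, dotp (E x - E y) (E x - E y) <= c * dotp (x - y) (x - y)) ->
  continuous E.
Proof.
move=> lip x; apply/(@cvgrPdist_lt _ _ _ (nbhs x)) => e e0.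
have cl : c * dotp (x - y) (x - y) @[y --> x] --> (0 : K).
  have cd : (fun y : V => (x : V) - y) @ (x : V) --> (x : V) - x.
    apply: (@cvgB _ _ _ (nbhs (x : V)) _ (cst x) id x x).
      exact: (@cvg_cst _ (x : V) _ (nbhs (x : V)) _).
    exact: cvg_id.
  have : c * dotp (x - y) (x - y) @[y --> x] --> c * dotp (x - x) (x - x).
    apply: (@cvgM _ _ (nbhs (x : V))).
      exact: (@cvg_cst _ c _ (nbhs (x : V)) _).
    exact: (@cvg_dotp _ _ _ (nbhs (x : V))).
  by rewrite subrr dotp0l mulr0.
have H : \forall y \near x, c * dotp (x - y) (x - y) < e ^+ 2.
  by move: cl => /cvgr_lt; apply; rewrite exprn_gt0.
apply: (@filterS _ (nbhs x) _ _ _ _ H) => y Hy.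
rewrite -(@ltr_pXn2r _ 2)// ?nnegrE ?(ltW e0)//.
exact: le_lt_trans (le_trans (sqr_norm_le_dotp _) (lip x y)) Hy.
Qed.

(** Combine strong convexity at [t y + (1 - t) p] with the subgradient inequality there, divide by
    [t] and let [t] tend to 0. *)
Lemma strongly_convex_subdiff (b : K) f p q : Defs.proper f ->
  strongly_convex b f -> subdiff f p q -> forall y, f y \is a fin_num ->
  fine (f p) + dotp q (y - p) + b / 2 * dotp (y - p) (y - p) <= fine (f y).
Proof.
move=> pf sc pq y fy; have fp := subdiff_fin_num pf pq.
set D := dotp (y - p) (y - p).
rewrite -subr_ge0; apply: (@ge0_small_perturbation _ _ (b / 2 * D)) => t t0 t1.
have := sc y p t t0 t1; rewrite sqr_enorm -/D -(fineK fp) -(fineK fy).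
set z := t *: y + (1 - t) *: p => H.
have fz : f z \is a fin_num.
  rewrite fin_numElt pf.1 /=.
  have := le_lt_trans H (ltry (t * fine (f y) + (1 - t) * fine (f p))).
  by case: (f z) => [r _||//]; rewrite ?ltry ?addye// ltxx.
have := subdiff_le pf pq fz.
have -> : z - p = t *: (y - p) by apply/rowP => i; rewrite !mxE; ring.
move: H; rewrite -(fineK fz) -!EFinM -!EFinD lee_fin dotpZr => H1 H2.
rewrite -(pmulr_rge0 _ t0).
move: H1 H2; move: (fine (f z)) (fine (f y)) (fine (f p)) (dotp q (y - p)).
by move=> A B C E /= H1 H2; lra.
Qed.

Lemma strongly_convex_monotone (b : K) f y w y' w' : Defs.proper f ->
  strongly_convex b f -> subdiff f y w -> subdiff f y' w' ->
  b * dotp (y - y') (y - y') <= dotp (w - w') (y - y').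
Proof.
move=> pf sc yw y'w'.
have := strongly_convex_subdiff pf sc yw (subdiff_fin_num pf y'w').
have := strongly_convex_subdiff pf sc y'w' (subdiff_fin_num pf yw).
rewrite -(opprB y y') !dotpNr !dotpNl (dotpBl w); lra.
Qed.

Lemma strongly_convex_lipschitz (b : K) f y w y' w' : 0 < b -> Defs.proper f ->
  strongly_convex b f -> subdiff f y w -> subdiff f y' w' ->
  dotp (y - y') (y - y') <= b ^- 2 * dotp (w - w') (w - w').
Proof.
move=> b0 pf sc yw y'w'; have := strongly_convex_monotone pf sc yw y'w'.
set d := y - y'; set o := w - w' => H.
rewrite mulrC ler_pdivlMr ?exprn_gt0//.
(* Expanding [0 <= |o - b d|^2] takes the place of the Cauchy-Schwarz inequality. *)
have := dotp_ge0 (o + (- b) *: d); rewrite dotp_sqrD => H2.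
have : b * (b * dotp d d) <= b * dotp o d by rewrite ler_wpM2l// ltW.
by move: H2; move: (dotp d d) (dotp o d) (dotp o o) => A B C; nra.
Qed.

(* A maximizing sequence for the conjugate at w is bounded by strong convexity;
   its cluster points are maximizers because f is lower semicontinuous. *)
Lemma strongly_convex_subdiff_surjective (b : K) f p q w : 0 < b ->
  Defs.proper f -> lower_semicontinuous f -> strongly_convex b f ->
  subdiff f p q -> exists y, subdiff f y w.
Proof.
move=> b0 pf lsc sc pq; have fp := subdiff_fin_num pf pq.
(* Half of the quadratic growth [b / 2] absorbs the linear term; the remaining [b / 4] will bound
   the maximizing sequence. *)
have young (o d : V) : dotp o d <= b / 4 * dotp d d + b^-1 * dotp o o.
  have := dotp_ge0 (o + (- (b / 2)) *: d); rewrite dotp_sqrD.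
  move: (dotp o d) (dotp d d) (dotp o o) => A B C H.
  rewrite -(ler_pM2l b0) mulrDr mulrA mulVKf ?gt_eqF//.
  by move: H; nra.
pose B := dotp w p - fine (f p) + b^-1 * dotp (w - q) (w - q).
have bound y : f y \is a fin_num ->
    dotp w y - fine (f y) <= B - b / 4 * dotp (y - p) (y - p).
  move=> fy; have := strongly_convex_subdiff pf sc pq fy.
  have := young (w - q) (y - p); rewrite (dotpBl w q) /B.
  move: (dotp (y - p) (y - p)) (dotp (w - q) (w - q)) => A1 A2.
  rewrite !dotpBr; move: (dotp w y) (dotp w p) (dotp q y) (dotp q p) => A3 A4 A5 A6.
  move: (b^-1 * A2) => A7; lra.
have cB : (conjugate f w <= B%:E)%E.
  apply: ge_ereal_sup => _ [y _ <-].
  have [fy|] := ltP (f y) +oo%E; last by rewrite leye_eq => /eqP ->; rewrite leNye.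
  have fy' : f y \is a fin_num by rewrite fin_numElt pf.1.
  rewrite -(fineK fy') -EFinB lee_fin; apply: le_trans (bound _ fy') _.
  by rewrite gerBl mulr_ge0 ?dotp_ge0// divr_ge0// ltW.
have cw : conjugate f w \is a fin_num.
  rewrite fin_numElt (le_lt_trans cB) ?ltry// andbT.
  by apply: lt_le_trans (conjugate_ge f w p); rewrite -(fineK fp) -EFinB ltNyr.
set s := fine (conjugate f w).
have /choice[Y HY] : forall k, exists y : V, f y \is a fin_num /\
    s - k.+1%:R^-1 < dotp w y - fine (f y).
  move=> k.
  have k0 : 0 < (k.+1%:R^-1 : K) by rewrite invr_gt0.
  have [_ [y _ <-] Hy] := ub_ereal_sup_adherent k0 cw.
  have fy : f y \is a fin_num.
    rewrite fin_numElt pf.1 ltey /=; apply/eqP => fy.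
    by move: Hy; rewrite fy ltNge leNye.
  exists y; split=> //; move: Hy.
  by rewrite -/(conjugate f w) -(fineK cw) -(fineK fy) -!EFinB lte_fin.
have [U [UU Uoo]] := @ultraFilterLemma nat \oo _.
(* The values along [Y] are at least [s - 1], so by [bound] the squared distance from [p] is at most
   [r]. *)
pose r := (B - s + 1) * 4 / b.
have Ybound : \forall k \near U, `|Y k| <= `|p| + (r + 1).
  apply: Uoo; near=> k.
  have [fY Yk] := HY k.
  have k1 : (k.+1%:R^-1 : K) <= 1 by rewrite invf_le1// ler1n.
  rewrite -[Y k](subrKC p); apply: le_trans (ler_normD _ _) _.
  rewrite lerD2l//.
  have D : dotp (Y k - p) (Y k - p) <= r.
    rewrite /r ler_pdivlMr//; have := bound _ fY; move: Yk k1.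
    move: (dotp (Y k - p) (Y k - p)) (dotp w (Y k)) (fine (f (Y k))) (k.+1%:R^-1).
    by move=> A1 A2 A3 A4; lra.
  have := le_trans (sqr_norm_le_dotp (Y k - p)) D.
  by move: `|Y k - p| => a; nra.
have [d cY] := ultra_bounded_cvg UU Ybound.
have fd : (f d <= (dotp w d - s)%:E)%E.
  (* A constant [c] strictly between the two sides lies below [f (Y k)] along the ultrafilter, which
     contradicts the near-maximality of [Y k] in the limit. *)
  rewrite leNgt; apply/negP => lt_fd.
  have [c c1 c2] : exists2 c : K, dotp w d - s < c & (c%:E < f d)%E.
    case: (f d) lt_fd => [a|_|//].
      rewrite lte_fin => lta; exists ((dotp w d - s + a) / 2).
        by move: lta; lra.
      by rewrite lte_fin; move: lta; lra.
    by exists (dotp w d - s + 1); rewrite ?ltry// ltrDl.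
  have [W Wd HW] := lsc d c c2.
  have cl : dotp w (Y k) - s + k.+1%:R^-1 @[k --> U] --> dotp w d - s + 0.
    apply: cvgD; first apply: cvgB; last by move=> A /cvg_harmonic; exact: Uoo.
      by apply: cvg_dotp => //; exact: cvg_cst.
    exact: cvg_cst.
  have : c <= dotp w d - s + 0.
    apply: (cvgr_to_ge cl); near=> k.
    have /HW : W (Y k) by near: k; exact: (cY _ Wd).
    have [fY Yk] := HY k; rewrite -(fineK fY) lte_fin => cf.
    apply/ltW/(lt_le_trans cf).
    have arith (a1 a2 a3 e : K) : a1 - e < a2 - a3 -> a3 <= a2 - a1 + e by lra.
    exact: arith.
  by rewrite addr0 leNgt c1.
exists d => y; have [fy|] := ltP (f y) +oo%E; last by rewrite leye_eq => /eqP ->; rewrite leey.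
have fy' : f y \is a fin_num by rewrite fin_numElt pf.1.
have := conjugate_ge f w y; rewrite -(fineK cw) -/s -(fineK fy') -EFinB lee_fin.
move=> H; apply: le_trans (leeD2r _ fd) _; rewrite -EFinD lee_fin dotpBr.
by move: H; lra.
Unshelve. all: by end_near. Qed.

(** [Y u] is a subgradient of the conjugate at [u], so a difference quotient along a coordinate lies
    between that coordinate of [Y w] and of [Y] at the shifted point; [Y] is continuous by
    [strongly_convex_lipschitz]. *)
Lemma egrad_conjugate (b : K) f (Y : V -> V) w : 0 < b -> Defs.proper f ->
  strongly_convex b f -> (forall u, subdiff f (Y u) u) ->
  egrad (conjugate f) w = Y w.
Proof.
move=> b0 pf sc HY.
have cY : continuous Y.
  apply: (@dotp_lipschitz_continuous _ _ (b ^- 2)) => x y.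
  exact: strongly_convex_lipschitz b0 pf sc (HY x) (HY y).
have fY u := subdiff_fin_num pf (HY u).
pose phi u := fine (conjugate f u).
have phiE u : phi u = dotp u (Y u) - fine (f (Y u)).
  by rewrite /phi (conjugate_subdiff (HY u)) -[in LHS](fineK (fY u)).
have phi_ge u v : phi u + dotp (v - u) (Y u) <= phi v.
  rewrite {1}phiE; have := conjugate_ge f v (Y u).
  have fv : conjugate f v \is a fin_num.
    by rewrite (conjugate_subdiff (HY v)) -(fineK (fY v)).
  by rewrite -(fineK (fY u)) -(fineK fv) -/(phi v) -EFinB lee_fin dotpBl; lra.
apply/rowP => i; rewrite mxE.
suff : is_derive w (delta_mx 0 i) phi (Y w 0 i) by case.
apply/is_derive_cvg; apply/cvgrPdist_le => e e0.
pose L s : V := s *: delta_mx 0 i + w.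
have cL : L @ (0 : K) --> w.
  have := @cvg_line K n w (delta_mx 0 i); apply: cvg_trans.
  by apply: near_eq_cvg; apply: nearW => s; rewrite /L addrC.
have cYi : (Y (L s)) 0 i @[s --> (0 : K)] --> Y w 0 i.
  by apply: cvg_coord; apply: (cvg_comp _ _ cL); exact: cY.
have N : \forall s \near (0 : K), `|Y w 0 i - Y (L s) 0 i| <= e.
  by move: cYi => /cvgrPdist_le; apply.
apply: (@filterS _ (nbhs (0 : K)) _ _ _ _ N) => s Ns s0.
rewrite -/(L s); apply: le_trans Ns.
have H1 := phi_ge w (L s); have H2 := phi_ge (L s) w.
rewrite /L addrK dotpZl dotp_deltal -/(L s) in H1.
rewrite -opprB /L addrK dotpNl dotpZl dotp_deltal -/(L s) in H2.
rewrite /GRing.scale /=; set Q := phi (L s) - phi w.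
have B1 : s * Y w 0 i <= Q by rewrite /Q; move: H1; lra.
have B2 : Q <= s * Y (L s) 0 i by rewrite /Q; move: H2; lra.
rewrite -[Q](mulVKf s0) in B1 B2; rewrite -/(s^-1 * Q).
move: B1 B2; move: (s^-1 * Q) (Y w 0 i) (Y (L s) 0 i) => z y1 y2.
(* The sign of the step decides which of the two values is the lower bound. *)
move: s0; rewrite neq_lt => /orP[s0|s0].
  rewrite !ler_nM2l// => z1 z2.
  by rewrite !ger0_norm ?subr_ge0 ?(le_trans z2)// lerB.
rewrite !ler_pM2l// => z1 z2.
by rewrite !ler0_norm ?subr_le0 ?(le_trans z1)// !opprB lerB.
Qed.

Lemma cvg_mulmx T (G : set_system T) {FG : Filter G} m (X : T -> V) x
    (A : 'M[K]_(n, m)) : X @ G --> x -> X t *m A @[t --> G] --> x *m A.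
Proof.
move=> Xx; apply: cvg_rowP => j.
have E (z : V) : (z *m A) 0 j = dotp z (col j A)^T.
  by rewrite mxE; apply: eq_bigr => i _; rewrite !mxE.
have H : dotp (X t) (col j A)^T @[t --> G] --> dotp x (col j A)^T.
  by apply: cvg_dotp => //; exact: cvg_cst.
by rewrite E; apply: cvg_trans H; apply: near_eq_cvg; apply: nearW => t.
Qed.

End StrongConvexity.

(** * Convergent sequences of points and subgradients *)

Section PartlySmoothSequences.
Context {K : realType} {n : nat}.
Local Notation V := 'rV[K]_n.
Implicit Types (f : V -> \bar K) (M : set V).

(** Fixes the threshold before [Q] is known, as needed when a single threshold precedes several
    conditional claims. *)
Lemma eventually_imp (Q : Prop) (P : nat -> Prop) :
  (Q -> \forall k \near \oo, P k) ->
  exists N : nat, Q -> forall k, (N <= k)%N -> P k.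
Proof.
have [q /(_ q)[N _ NP]|nq _] := pselect Q; last by exists 0%N.
by exists N => _ k Nk; exact: NP.
Qed.

(** Serves for [R] with the primal iterates and for the conjugate of [J] with the dual ones. The
    index shift reflects that a proximal step yields a subgradient at the new iterate. *)
Lemma partly_smooth_sequence f M xs us (x u : nat -> V) : Defs.proper f ->
  partly_smooth f M xs -> rel_interior (subdiff f xs) us ->
  x @ \oo --> xs -> u @ \oo --> us -> (forall k, subdiff f (x k.+1) (u k)) ->
  [/\ \forall k \near \oo, M (x k),
    locally_equal xs M (translate xs (Tspace f xs)) ->
      \forall k \near \oo, Tspace f (x k) = Tspace f xs &
    locally_polyhedral f xs ->
      locally_equal xs M (translate xs (Tspace f xs)) /\
      \forall k \near \oo,
        [/\ M (x k) /\ translate xs (Tspace f xs) (x k),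
            Tspace f (x k) = Tspace f xs,
            exists2 g, is_riem_grad M f xs g & is_riem_grad M f (x k) g &
            is_riem_hess M f (x k) 0]].
Proof.
move=> pf ps ri cx cu xu.
have Mxs : M xs by have [_ [[]]] := ps.
have MS : \forall k \near \oo, M (x k.+1).
  have cxS : (fun k => x k.+1) @ \oo --> xs by rewrite (cvg_shiftS x).
  have [[P Q] /= [xP usQ] PQ] := partly_smooth_identification pf ps ri.
  have HP := cxS _ xP; have HQ := cu _ usQ.
  near=> k; apply: (PQ (x k.+1, u k)); last exact: xu.
  by split; near: k.
have Mx : \forall k \near \oo, M (x k).
  have [N _ NM] := MS; exists N.+1 => // k /=.
  by case: k => // k Nk; exact: NM.
have TE : locally_equal xs M (translate xs (Tspace f xs)) ->
    \forall k \near \oo, Tspace f (x k) = Tspace f xs.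
  move=> loc; have H := cx _ (Tspace_locally_constant pf ps loc).
  near=> k; have : M (x k) by near: k.
  by near: k.
split=> // lp.
have [loc aff] := polyhedral_manifold_affine pf ps ri lp.
have [g gP] := riemannian_affine loc aff.
split=> //; have Hg := cx _ gP; have Hl := cx _ loc; have HT := TE loc.
have [gxs _] := nbhs_singleton gP Mxs.
near=> k.
have Mk : M (x k) by near: k.
have [gk hk] : is_riem_grad M f (x k) g /\ is_riem_hess M f (x k) 0.
  by move: Mk; near: k.
have [lk _] : M (x k) <-> translate xs (Tspace f xs) (x k) by near: k.
split=> //; first by split=> //; exact: lk.
- by near: k.
- by exists g.
Unshelve. all: by end_near. Qed.

End PartlySmoothSequences.

(** * Identification for the primal-dual iteration *)

Theorem theorem3p3 (K : realType) (n m : nat)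
  (R F : 'rV[K]_n -> \bar K) (J G : 'rV[K]_m -> \bar K)
  (L : {linear 'rV[K]_n -> 'rV[K]_m}) (betaF betaG : K)
  (hR : Gamma0 R) (hF : Gamma0 F)
  (hbetaF : 0 < betaF) (hFlip : lipschitz_gradient (1 / betaF) F)
  (hJ : Gamma0 J) (hG : Gamma0 G)
  (hbetaG : 0 < betaG) (hGsc : strongly_convex betaG G)
  (hran : range_condition R F J G L)
  (gR gJ : K) (hgR : 0 < gR) (hgJ : 0 < gJ)
  (hstep : 2 * Num.min betaF betaG * Num.min (1 / gJ) (1 / gR)
             * (1 - Num.sqrt (gJ * gR * opnorm L ^+ 2)) > 1)
  (x xbar : nat -> 'rV[K]_n) (v : nat -> 'rV[K]_m)
  (hiter : primal_dual_iteration R F J G L gR gJ 1 x xbar v)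
  (xs : 'rV[K]_n) (vs : 'rV[K]_m)
  (hKT : Kuhn_Tucker R F J G L xs vs)
  (hcvg : (x k, v k) @[k --> \oo] --> (xs, vs))
  (MR : set 'rV[K]_n) (MJ : set 'rV[K]_m)
  (hMR : partly_smooth R MR xs)
  (hMJ : partly_smooth (conjugate J) MJ vs)
  (hndR : rel_interior (subdiff R xs) (- adjoint L vs - egrad F xs))
  (hndJ : rel_interior (subdiff (conjugate J) vs)
            (L xs - egrad (conjugate G) vs)) :
  exists N : nat,
  (forall k, (N <= k)%N -> MR (x k) /\ MJ (v k)) /\
  [/\
    locally_equal xs MR (translate xs (Tspace R xs)) ->
      forall k, (N < k)%N -> Tspace R (x k) = Tspace R xs /\ MR (xbar k),
    locally_equal vs MJ (translate vs (Tspace (conjugate J) vs)) ->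
      forall k, (N < k)%N ->
        Tspace (conjugate J) (v k) = Tspace (conjugate J) vs,
    locally_polyhedral R xs ->
      locally_equal xs MR (translate xs (Tspace R xs)) /\
      forall k, (N <= k)%N ->
        [/\ MR (x k) /\ translate xs (Tspace R xs) (x k),
            Tspace R (x k) = Tspace R xs,
            exists2 g, is_riem_grad MR R xs g & is_riem_grad MR R (x k) g &
            is_riem_hess MR R (x k) 0] &
    locally_polyhedral (conjugate J) vs ->
      locally_equal vs MJ (translate vs (Tspace (conjugate J) vs)) /\
      forall k, (N <= k)%N ->
        [/\ MJ (v k) /\ translate vs (Tspace (conjugate J) vs) (v k),
            Tspace (conjugate J) (v k) = Tspace (conjugate J) vs,
            exists2 g, is_riem_grad MJ (conjugate J) vs g
                     & is_riem_grad MJ (conjugate J) (v k) g &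
            is_riem_hess MJ (conjugate J) (v k) 0]].
Proof.
have [pR cR _] := hR; have [pJ cJ _] := hJ; have [pG cG lG] := hG.
(* The range condition provides subgradients of [J] and of [G]: the former makes the conjugate of
   [J] proper, the latter starts the construction of the gradient of the conjugate of [G]. *)
have [x0 [u0 [w0 [_ [a Ja [b Gb _]] _]]]] := hran.
have pJs : Defs.proper (conjugate J) := proper_conjugate pJ Ja.
have cJs : econvex (conjugate J) by apply: econvex_conjugate; have [] := pJ.
have cF : continuous (egrad F).
  have [_ _ lip] := hFlip.
  apply: (@dotp_lipschitz_continuous _ _ _ _ ((1 / betaF) ^+ 2)) => y z.
  rewrite -!sqr_enorm -exprMn lerXn2r// nnegrE ?enorm_ge0//.
  by rewrite mulr_ge0 ?enorm_ge0// divr_ge0// ltW.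
have /choice[Y HY] : forall w, exists y, subdiff G y w.
  move=> w; exact: strongly_convex_subdiff_surjective hbetaG pG lG hGsc Gb.
have cGs : continuous (egrad (conjugate G)).
  have -> : egrad (conjugate G) = Y.
    by apply/funext => w; exact: egrad_conjugate hbetaG pG hGsc HY.
  apply: (@dotp_lipschitz_continuous _ _ _ _ (betaG ^- 2)) => y z.
  exact: strongly_convex_lipschitz hbetaG pG hGsc (HY y) (HY z).
have cx : x @ \oo --> xs.
  by move=> A xA; apply: (hcvg (fst @^-1` A)); exact: (cvg_fst xA).
have cv : v @ \oo --> vs.
  by move=> A vA; apply: (hcvg (snd @^-1` A)); exact: (cvg_snd vA).
have cxS : (fun k => x k.+1) @ \oo --> xs.
  by rewrite (cvg_shiftS x); exact: cx.
have cvS : (fun k => v k.+1) @ \oo --> vs.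
  by rewrite (cvg_shiftS v); exact: cv.
have cxb : (fun k => xbar k.+1) @ \oo --> xs.
  have -> : (fun k => xbar k.+1) = (fun k => x k.+1 + (x k.+1 - x k)).
    by apply/funext => k; have [_ -> _] := hiter k; rewrite scale1r.
  have H : (fun k => x k.+1 + (x k.+1 - x k)) @ \oo --> xs + (xs - xs).
    by apply: cvgD; [exact: cxS|apply: cvgB; [exact: cxS|exact: cx]].
  by move: H; rewrite subrr addr0.
have cFx : egrad F (x k) @[k --> \oo] --> egrad F xs.
  exact: (cvg_comp _ _ cx (cF xs)).
have cGv : egrad (conjugate G) (v k) @[k --> \oo] --> egrad (conjugate G) vs.
  exact: (cvg_comp _ _ cv (cGs vs)).
have cLv : adjoint L (v k) @[k --> \oo] --> adjoint L vs.
  by rewrite /adjoint; apply: cvg_mulmx; exact: cv.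
have cLx : L (xbar k.+1) @[k --> \oo] --> L xs.
  have -> : (fun k => L (xbar k.+1)) = (fun k => xbar k.+1 *m lin1_mx L).
    by apply/funext => k; rewrite mul_rV_lin1.
  by rewrite -mul_rV_lin1; apply: cvg_mulmx; exact: cxb.
(* Subgradient given by the primal proximal step. In its limit the two copies of [xs] cancel, which
   leaves the vector of the non-degeneracy condition. *)
pose uR k := gR^-1 *: (x k - gR *: egrad F (x k) - gR *: adjoint L (v k) - x k.+1).
have subR k : subdiff R (x k.+1) (uR k).
  by have [prR _ _] := hiter k; exact: prox_subdiff hgR pR cR prR.
have cuR : uR @ \oo --> - adjoint L vs - egrad F xs.
  have -> : - adjoint L vs - egrad F xs =
      gR^-1 *: (xs - gR *: egrad F xs - gR *: adjoint L vs - xs).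
    by apply/rowP => i; rewrite !mxE; field; rewrite gt_eqF.
  apply: cvgZ; first exact: cvg_cst.
  apply: cvgB; last exact: cxS.
  apply: cvgB; first apply: cvgB; first exact: cx.
    by apply: cvgZ; [exact: cvg_cst|exact: cFx].
  by apply: cvgZ; [exact: cvg_cst|exact: cLv].
pose uJ k := gJ^-1 *: (v k - gJ *: egrad (conjugate G) (v k)
  + gJ *: L (xbar k.+1) - v k.+1).
have subJ k : subdiff (conjugate J) (v k.+1) (uJ k).
  by have [_ _ prJ] := hiter k; exact: prox_subdiff hgJ pJs cJs prJ.
have cuJ : uJ @ \oo --> L xs - egrad (conjugate G) vs.
  have -> : L xs - egrad (conjugate G) vs =
      gJ^-1 *: (vs - gJ *: egrad (conjugate G) vs + gJ *: L xs - vs).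
    by apply/rowP => i; rewrite !mxE; field; rewrite gt_eqF.
  apply: cvgZ; first exact: cvg_cst.
  apply: cvgB; last exact: cvS.
  apply: cvgD; first apply: cvgB; first exact: cv.
    by apply: cvgZ; [exact: cvg_cst|exact: cGv].
  by apply: cvgZ; [exact: cvg_cst|exact: cLx].
have [MRx TRx polR] := partly_smooth_sequence pR hMR hndR cx cuR subR.
have [MJv TJv polJ] := partly_smooth_sequence pJs hMJ hndJ cv cuJ subJ.
have [N1 H1] := @eventually_imp True _ (fun=> MRx).
have [N2 H2] := @eventually_imp True _ (fun=> MJv).
have [N3 H3] := eventually_imp TRx.
(* [MR] agrees with an affine space only near [xs], so the extrapolated points get their own
   threshold, past which they are close to [xs]. *)
have [N4 H4] : exists N, locally_equal xs MR (translate xs (Tspace R xs)) ->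
    forall k, (N <= k)%N -> MR (xbar k.+1).
  apply: eventually_imp => loc.
  have Hb := cxb _ loc; have Hx := cx _ loc; have HxS := cxS _ loc.
  near=> k.
  have [_ ] : MR (xbar k.+1) <-> translate xs (Tspace R xs) (xbar k.+1) by near: k.
  apply.
  have [T1 _] : MR (x k) <-> translate xs (Tspace R xs) (x k) by near: k.
  have [T2 _] : MR (x k.+1) <-> translate xs (Tspace R xs) (x k.+1) by near: k.
  have Nk : (N1 <= k)%N by near: k; exact: nbhs_infty_ge.
  have M1 : MR (x k) by exact: H1.
  have M2 : MR (x k.+1) by apply: H1 => //; exact: leqW.
  have [_ -> _] := hiter k.
  have -> : translate xs (Tspace R xs) (x k.+1 + 1 *: (x k.+1 - x k)) =
     Tspace R xs ((x k.+1 - xs) + ((x k.+1 - xs) - (x k - xs))).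
    by rewrite /translate /=; congr (Tspace R xs _); apply/rowP => i; rewrite !mxE; ring.
  by apply: orthogonalD; [exact: T2|apply: orthogonalB; [exact: T2|exact: T1]].
have [N5 H5] := eventually_imp TJv.
have [N6 H6] := eventually_imp (fun lp => (polR lp).2).
have [N7 H7] := eventually_imp (fun lp => (polJ lp).2).
exists (N1 + N2 + N3 + N4 + N5 + N6 + N7)%N; split.
  by move=> k Nk; split; [apply: H1|apply: H2] => //; lia.
split.
(* The iteration determines [xbar] only from index 1 on; [N < k] rules out [k = 0]. *)
- move=> loc [//|k] Nk; split; first by apply: H3 => //; lia.
  by apply: H4 => //; lia.
- by move=> loc k Nk; apply: H5 => //; lia.
- by move=> lp; split; [exact: (polR lp).1|move=> k Nk; apply: H6 => //; lia].
- by move=> lp; split; [exact: (polJ lp).1|move=> k Nk; apply: H7 => //; lia].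
Unshelve. all: by end_near. Qed.
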